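(* Assume $\sqrt3\leq v\leq u$. For any unimodal random variable $Z$ with mean $0$ and variance $1$, the inequality $$P(Z\leq -u \text{ or } Z\geq v)\leq \begin{cases}\dfrac49\,\dfrac{4+(u-v)^2}{(u+v)^2} & \text{for } v\leq u\leq v+\frac2v,\\[2mm] \dfrac49\,\dfrac{1}{1+v^2} & \text{for } v+\frac2v\leq u,\end{cases}$$ holds. For $v\leq u\leq v+\frac2v$ equality is attained if $Z=(v-u)/2+UY$, where $U$ and $Y$ are independent random variables, $U$ is uniform on the unit interval, and $Y$ takes the values $-\frac34(u+v)$, $0$, $\frac34(u+v)$ with probabilities $$\frac43\,\frac{2+v(v-u)}{(u+v)^2},\qquad 1-\frac43\,\frac{4+(v-u)^2}{(u+v)^2},\qquad \frac43\,\frac{2+u(u-v)}{(u+v)^2},$$ respectively. For $v+\frac2v\leq u$ equality is attained if $Z$ has mass $(3v^2-1)/(3(1+v^2))$ at $-1/v$ and the rest of its mass, $4/(3(1+v^2))$, uniformly distributed on the interval $[-1/v,\,(1+3v^2)/(2v)]$.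
   Context: A distribution on $\mathbb{R}$ is unimodal with mode at $M$ if its distribution function is convex on $(-\infty,M)$ and concave on $[M,\infty)$; it is unimodal if this holds for some real $M$. (A unimodal distribution may thus have an atom, but only at the mode $M$.) *)

(* Defs.v *)
From HB Require Import structures.
From mathcomp Require Export all_boot all_order all_algebra.
From mathcomp Require Export all_classical all_reals all_analysis.

Set Implicit Arguments.
Unset Strict Implicit.
Unset Printing Implicit Defensive.

Import Order.TTheory GRing.Theory Num.Theory.
Import numFieldNormedType.Exports.
Local Open Scope classical_set_scope.
Local Open Scope ring_scope.

Definition unimodal_at (d : measure_display) (T : measurableType d)
    (R : realType) (P : probability T R) (Z : {RV P >-> R}) (M : R) : Prop :=
  let F (x : R) : R := fine (cdf Z x) in
  convex_function (`]-oo, M[%classic : set R) F /\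
  convex_function (`[M, +oo[%classic : set R) (fun x => - F x).

(* 'E_P[Z] = 0 already forces Z to be integrable, since the extended-real
   convention is +oo - oo = -oo. *)
Definition standard_unimodal (d : measure_display) (T : measurableType d)
    (R : realType) (P : probability T R) (Z : {RV P >-> R}) : Prop :=
  [/\ exists M : R, unimodal_at Z M, ('E_P[Z] = 0)%E & ('V_P[Z] = 1)%E].

Definition independent_RVs (d : measure_display) (T : measurableType d)
    (R : realType) (P : probability T R) (X Y : {RV P >-> R}) : Prop :=
  forall A B : set R, measurable A -> measurable B ->
    P (X @^-1` A `&` Y @^-1` B) = (P (X @^-1` A) * P (Y @^-1` B))%E.

Definition outside_prob (d : measure_display) (T : measurableType d)
    (R : realType) (P : probability T R) (u v : R) (Z : {RV P >-> R}) : \bar R :=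
  P [set w | Z w <= - u \/ v <= Z w].

Definition scale_mixture_extremal (d : measure_display) (T : measurableType d)
    (R : realType) (P : probability T R) (u v : R) (U Y Z : {RV P >-> R})
    : Prop :=
  [/\ forall A : set R, measurable A ->
        distribution P U A = uniform_prob (@ltr01 R) A,
      [/\ P [set w | Y w = - (3 / 4 * (u + v))] =
            (4 / 3 * ((2 + v * (v - u)) / (u + v) ^+ 2))%:E,
          P [set w | Y w = 0] =
            (1 - 4 / 3 * ((4 + (v - u) ^+ 2) / (u + v) ^+ 2))%:E &
          P [set w | Y w = 3 / 4 * (u + v)] =
            (4 / 3 * ((2 + u * (u - v)) / (u + v) ^+ 2))%:E],
      independent_RVs U Y &
      forall w, Z w = (v - u) / 2 + U w * Y w].

Definition atom_uniform_extremal (d : measure_display) (T : measurableType d)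
    (R : realType) (P : probability T R) (v : R) (Z : {RV P >-> R}) : Prop :=
  exists ab : - v^-1 < (1 + 3 * v ^+ 2) / (2 * v),
  forall A : set R, measurable A ->
    distribution P Z A =
      (((3 * v ^+ 2 - 1) / (3 * (1 + v ^+ 2)))%R%:E * \d_(- v^-1)%R A +
       (4 / (3 * (1 + v ^+ 2)))%R%:E * uniform_prob ab A)%E.

(* Main.v *)
From HB Require Import structures.
Require Import Defs.
From mathcomp Require Import measurable_realfun ring lra.

Set Implicit Arguments.
Unset Strict Implicit.
Unset Printing Implicit Defensive.

Import Order.TTheory GRing.Theory Num.Theory.
Import numFieldNormedType.Exports.
Local Open Scope classical_set_scope.
Local Open Scope ring_scope.

(** Both bounds are instances of the inequality of Vysochanskii and Petunin
    with a free centre: if Z is unimodal, s = E (Z - c)^2 and 8 s <= 3 k^2, then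
    P (|Z - c| >= k) <= 4 s / (9 k^2), wherever the mode lies
    ([vysochanskii_petunin]).  For a standardized Z one has s = 1 + c^2, and
    the event in question is contained in {|Z - c| >= k} as soon as c + k <= v
    and k - c <= u.  Near the diagonal the centre c = (v - u) / 2 with
    k = (u + v) / 2 uses both constraints; further away only v matters, and
    c = - 1 / v with k = v + 1 / v minimizes (1 + c^2) / (v - c)^2.  The
    hypothesis sqrt 3 <= v is what makes 8 (1 + c^2) <= 3 k^2 true in both
    cases.

    For the inequality itself put X = (Z - c) / k, let N be the mode of X and
    m = min (|N|, 1).  It suffices to show that the test function
      g (x) = 4 x^2 - m^2 - 3 (3 - 2 m^2) 1_{|x| >= 1}
    satisfies E g(X) >= 0: this reads
      3 (3 - 2 m^2) P (|X| >= 1) <= 4 E X^2 - m^2,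
    and the right-hand side divided by 3 (3 - 2 m^2) is at most 4/9 E X^2
    because E X^2 <= 3/8.  As g is even and g (N) >= 0, and as the reflected
    variable - X is again of the same kind, only the part of the law to the
    right of the mode needs work ([vp_tail]).

    There the distribution function is concave, so that every point t has a
    slope a such that the law dominates a times Lebesgue measure between the
    mode and t, and is dominated by it beyond t
    ([concave_after_density_closed]).  Choosing such points where g changes
    from positive to negative replaces the unknown law by a step density, for
    which the integral of g is explicit.  What remains is the cubic inequality
    8 y^3 <= 27 - 18 m^2 - m^3 with 4 y^2 = 9 - 5 m^2 ([vp_cubic]).  The
    domination on intervals extends to all Borel sets because the
    difference of the two distribution functions is itself the distribution
    function of a measure ([le_measure_ocitv]).

    The extremal laws are mixtures of an atom at the mode and of two
    uniform laws on adjacent intervals: for c + U Y one conditions on the value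
    of Y ([scale_mixture_law]).  Their moments, distribution functions and
    tails are then computed directly. *)

(** * Comparing measures through half-open intervals *)

Lemma lebesgue_stieltjes_measure_itv (R : realType) (f : cumulative R R) (a b
  : R) :
  a <= b -> lebesgue_stieltjes_measure f `]a, b]%classic = (f b - f a)%:E.
Proof.
move=> ab; rewrite /lebesgue_stieltjes_measure /measure_extension/=.
rewrite measurable_mu_extE/= ?wlength_itv_bnd//; exact: is_ocitv.
Qed.

Lemma finite_measure_right_continuous (R : realType)
    (m : {finite_measure set (measurableTypeR R) -> \bar R}) :
  right_continuous (fun x : R => fine (m `]-oo, x]%classic)).
Proof.
move=> a.
pose I n : set R := `]-oo, a + n.+1%:R^-1]%classic.
have mI n : measurable (I n : set (measurableTypeR R)) by exact: measurable_itv.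
have capI : \bigcap_n I n = `]-oo, a]%classic by rewrite /I -itvNycEbigcap.
have cvgI : fine (m (I n)) @[n --> \oo] --> fine (m `]-oo, a]%classic).
  apply: fine_cvg; rewrite fineK ?fin_num_measure//.
  rewrite -capI; apply: nonincreasing_cvg_mu => //.
  - by rewrite -ge0_fin_numE// fin_num_measure.
  - by apply: bigcap_measurable => // n _; exact: mI.
  - move=> p n pn; apply/subsetPset; apply: subset_itvl.
    by rewrite bnd_simp lerD2l lef_pV2 ?posrE// ler_nat.
have ndm (x y : R) : x <= y ->
    fine (m `]-oo, x]%classic) <= fine (m `]-oo, y]%classic).
  move=> xy; rewrite fine_le ?fin_num_measure ?le_measure ?inE//;
    try exact: measurable_itv.
  by apply: subset_itvl; rewrite bnd_simp.
apply/cvgrPdist_le => e e0.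
move/cvgrPdist_le : cvgI => /(_ e e0) [N _ /(_ N (leqnn N))].
rewrite distrC ger0_norm ?subr_ge0; last by apply: ndm; rewrite lerDl.
move=> IN; near=> x; rewrite distrC ger0_norm ?subr_ge0; last by apply: ndm;
  near: x; exact: nbhs_right_ge.
apply: le_trans IN; rewrite lerD2r; apply: ndm.
by near: x; apply: nbhs_right_le; rewrite ltrDl.
Unshelve. all: by end_near. Qed.

(** The difference G of the two distribution functions is nondecreasing and
    right-continuous, so m2 is m1 plus the Lebesgue-Stieltjes measure of G. *)
Lemma le_measure_ocitv (R : realType)
    (m1 m2 : {finite_measure set (measurableTypeR R) -> \bar R}) :
  (forall a b : R, a <= b -> (m1 `]a, b]%classic <= m2 `]a, b]%classic)%E) ->
  forall A : set (measurableTypeR R), measurable A -> (m1 A <= m2 A)%E.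
Proof.
move=> m12.
pose F (m : {finite_measure set (measurableTypeR R) -> \bar R}) (x : R) :=
  fine (m `]-oo, x]%classic).
have Fitv (m : {finite_measure set (measurableTypeR R) ->
  \bar R}) (a b : R) : a <= b ->
    m `]a, b]%classic = (F m b - F m a)%:E.
  move=> ab; rewrite EFinB !fineK ?fin_num_measure//; try exact: measurable_itv.
  have -> : `]a, b]%classic = `]-oo, b] `\` `]-oo, a] :> set R.
    by rewrite -[RHS]setCK setCD setCitvl setUC -[LHS]setCK setCitv.
  rewrite measureD ?setIidr//; try exact: measurable_itv;
    first exact: subset_itvl.
  by rewrite -ge0_fin_numE// fin_num_measure//; exact: measurable_itv.
pose G x := F m2 x - F m1 x.
have Gnd : nondecreasing G.
  move=> a b ab; move: (m12 _ _ ab); rewrite !Fitv// lee_fin /G; lra.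
have Grc : right_continuous G.
  by move=> x; apply: cvgB; exact: finite_measure_right_continuous.
pose Gm := isCumulative.Build _ _ R G Gnd Grc.
pose Gc : cumulative R R := HB.pack G Gm.
pose nu : {measure set (measurableTypeR R) -> \bar R} :=
  measure_add m1 (lebesgue_stieltjes_measure Gc).
have lsE (a b : R) : a <= b ->
    lebesgue_stieltjes_measure Gc `]a, b]%classic = (G b - G a)%:E.
  exact: lebesgue_stieltjes_measure_itv.
have nuD A : nu A = (m1 A + lebesgue_stieltjes_measure Gc A)%E.
  exact: measure_addE.
have nuE (A : set (measurableTypeR R)) : measurable A -> nu A = m2 A.
  move=> mA; apply: (@measure_unique _ R (measurableTypeR R) (@ocitv R)
    (fun n : nat => `](- n%:R)%R, (n%:R)%R]%classic) erefl (@ocitvI R)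
    (fun n => is_ocitv _ _) (bigcup_itvT false false) nu m2) => //.
  - move=> _ [[a b] _ <-] /=; have [ab|ba] := leP a b; last first.
      by rewrite set_itv_ge ?measure0// bnd_simp -leNgt ltW.
    rewrite nuD lsE// !Fitv// -EFinD; congr EFin; rewrite /G; lra.
  - move=> n; rewrite nuD lsE ?lte_add_pinfty ?ltry//.
      by rewrite -ge0_fin_numE// fin_num_measure//; exact: measurable_itv.
    by rewrite ge0_cp.
by move=> A mA; rewrite -(nuE A mA) nuD leeDl.
Qed.

Lemma le_measure_on_ocitv (R : realType)
    (m1 m2 : {measure set (measurableTypeR R) -> \bar R}) (p q : R) :
  (m1 `]p, q]%classic < +oo)%E -> (m2 `]p, q]%classic < +oo)%E ->
  (forall a b : R, p <= a -> a <= b -> b <= q ->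
    (m1 `]a, b]%classic <= m2 `]a, b]%classic)%E) ->
  forall A : set (measurableTypeR R), measurable A -> A `<=` `]p, q]%classic ->
    (m1 A <= m2 A)%E.
Proof.
move=> m1oo m2oo m12 A mA Apq.
have mD : measurable (`]p, q]%classic : set (measurableTypeR R)).
  exact: measurable_itv.
suff : (mfrestr mD m1oo A <= mfrestr mD m2oo A)%E.
  by rewrite /mfrestr /mrestr (setIidl Apq).
apply: le_measure_ocitv => // a b ab; rewrite /= /mfrestr /mrestr.
have -> : `]a, b] `&` `]p, q] =
    `]Num.max a p, Num.min b q]%classic :> set (measurableTypeR R).
  apply/seteqP; split => x /=; rewrite !in_itv/= gt_max le_min.
    by move=> [/andP[-> ->] /andP[-> ->]].
  by move=> /andP[/andP[-> ->] /andP[-> ->]].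
have [le|lt] := leP (Num.max a p) (Num.min b q).
  by apply: m12 => //; rewrite ?le_max ?ge_min lexx orbT.
by rewrite set_itv_ge ?measure0// bnd_simp -leNgt ltW.
Qed.

(** * Concave distribution functions have nonincreasing densities *)

(** Concavity in chord form on the open ray to the right of M: this is what
    both halves of unimodality have in common after a reflection. *)
Definition concave_after (R : realType) (F : R -> R) (M : R) : Prop :=
  forall a b d, M < a -> a < b -> b < d ->
    (F d - F b) * (b - a) <= (F b - F a) * (d - b).

(** The slope is the right derivative at c, obtained as the supremum of the
    chord slopes to the right of c; the chords ending at c bound it from
    above. *)
Lemma concave_after_slope (R : realType) (F : R -> R) (M c : R) :
  concave_after F M -> (forall a b, M < a -> a <= b -> F a <= F b) -> M < c ->
  exists k : R, [/\ 0 <= k,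
    forall s t, M < s -> s <= t -> t <= c -> k * (t - s) <= F t - F s &
    forall s t, c <= s -> s <= t -> F t - F s <= k * (t - s)].
Proof.
move=> cF ndF Mc.
pose S := [set (F t - F c) / (t - c) | t in `]c, +oo[%classic].
have Sub s : M < s -> s < c -> ubound S ((F c - F s) / (c - s)).
  move=> Ms sc _ [t /= + <-]; rewrite in_itv/= andbT => ct.
  rewrite ler_pdivrMr ?subr_gt0// mulrAC ler_pdivlMr ?subr_gt0//.
  exact: cF.
have S0 : S !=set0 by exists ((F (c + 1) - F c) / (c + 1 - c)), (c + 1) => //=;
  rewrite in_itv/= andbT ltrDl.
have hubS : has_ubound S.
  exists ((F c - F ((M + c) / 2)) / (c - (M + c) / 2)); apply: Sub; lra.
have kR t : c < t -> F t - F c <= sup S * (t - c).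
  move=> ct; rewrite -ler_pdivrMr ?subr_gt0//; apply: ub_le_sup => //.
  by exists t => //=; rewrite in_itv/= andbT.
have kL s : M < s -> s < c -> sup S * (c - s) <= F c - F s.
  move=> Ms sc; rewrite -ler_pdivlMr ?subr_gt0//; apply: ge_sup => //.
  exact: Sub.
exists (sup S); split.
- have := kR (c + 1); rewrite ltrDl ltr01 => /(_ isT).
  have : F c <= F (c + 1) by apply: ndF => //; rewrite lerDl.
  by rewrite addrAC subrr add0r mulr1; lra.
- move=> s t Ms; rewrite le_eqVlt => /predU1P[->|st];
    first by rewrite !subrr mulr0.
  rewrite le_eqVlt => /predU1P[tc|tc]; first by subst t; exact: kL.
  have ct0 : 0 < c - t by rewrite subr_gt0.
  rewrite -(ler_pM2r ct0); apply: le_trans (cF s t c Ms st tc).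
  rewrite mulrAC ler_pM2r ?subr_gt0//; apply: kL => //; exact: lt_trans st.
- move=> s t; rewrite le_eqVlt => /predU1P[<-|cs].
    by rewrite le_eqVlt => /predU1P[->|/kR//]; rewrite !subrr mulr0.
  rewrite le_eqVlt => /predU1P[->|st]; first by rewrite !subrr mulr0.
  have sc0 : 0 < s - c by rewrite subr_gt0.
  rewrite -(ler_pM2r sc0); apply: le_trans (cF c s t Mc cs st) _.
  by rewrite mulrAC ler_pM2r ?subr_gt0//; exact: kR.
Qed.

Section density.
Context (R : realType).
Context (mu : {finite_measure set (measurableTypeR R) -> \bar R}).
Context (F : R -> R) (M : R).
Hypothesis muF : forall a b : R, M < a -> a <= b ->
  mu `]a, b]%classic = (F b - F a)%:E.
Hypothesis cF : concave_after F M.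
Local Notation leb := (@lebesgue_measure R).

Let ndF (a b : R) : M < a -> a <= b -> F a <= F b.
Proof.
by move=> Ma ab; rewrite -subr_ge0 -lee_fin -muF// measure_ge0.
Qed.

Let lebE (a b : R) : a <= b -> leb `]a, b]%classic = (b - a)%:E.
Proof.
move=> ab; rewrite lebesgue_measure_itv/= lte_fin; case: ltP => [//|ba].
have -> : a = b by apply/eqP; rewrite eq_le ab ba.
by rewrite subrr.
Qed.

(** Serves as a substitute for a monotone density: beyond c the density is at
    most k, and between M and c it is at least k. *)
Lemma concave_after_density c : M < c ->
  exists k : R, [/\ 0 <= k,
    forall A : set (measurableTypeR R), measurable A ->
      A `<=` `]M, c]%classic ->
      (k%:E * leb A <= mu A)%E &
    forall (A : set (measurableTypeR R)) d, measurable A ->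
      A `<=` `]c, d]%classic ->
      (mu A <= k%:E * leb A)%E].
Proof.
move=> Mc; have [k [k0 kL kR]] := concave_after_slope cF ndF Mc.
pose kleb : {measure set (measurableTypeR R) -> \bar R} :=
  mscale (NngNum k0) leb.
have klebE A : kleb A = (k%:E * leb A)%E by [].
have kleboo (a b : R) : (kleb `]a, b]%classic < +oo)%E.
  rewrite klebE; have [ab|ba] := leP a b; first by rewrite lebE// -EFinM ltry.
  by rewrite set_itv_ge ?measure0 ?mule0// bnd_simp -leNgt ltW.
have muoo (A : set (measurableTypeR R)) : measurable A -> (mu A < +oo)%E.
  by move=> mA; rewrite -ge0_fin_numE// fin_num_measure.
exists k; split=> // [A mA AMc|A d mA Acd]; last first.
  rewrite -klebE; apply: (@le_measure_on_ocitv _ _ _ c d) => //.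
    by apply: muoo; exact: measurable_itv.
  move=> a b ca ab _;
    suff : (mu `]a, b]%classic <= kleb `]a, b]%classic)%E by [].
  rewrite muF ?(lt_le_trans Mc)// klebE lebE// -EFinM lee_fin; exact: kR.
(* F is only controlled on the open ray, hence sets are cut at a point t close
   enough to M for the lost piece to have k-weight at most e. *)
apply/lee_addgt0Pr => e e0.
pose t := Num.min c (M + e / (k + 1)).
have k10 : 0 < k + 1 by lra.
have Mt : M < t by rewrite lt_min Mc ltrDl divr_gt0.
have tc : t <= c by rewrite ge_min lexx.
have mAt : measurable (A `&` `]t, c]%classic : set (measurableTypeR R)).
  by apply: measurableI => //; exact: measurable_itv.
have h1 : (k%:E * leb (A `&` `]t, c]%classic) <= mu A)%E.
  apply: (@le_trans _ _ (mu (A `&` `]t, c]%classic))); last first.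
    by apply: le_measure; rewrite ?inE//; exact: subIsetl.
  rewrite -klebE; apply: (@le_measure_on_ocitv _ _ _ t c) => //.
    by apply: muoo; exact: measurable_itv.
  move=> a b ta ab bc.
  suff : (kleb `]a, b]%classic <= mu `]a, b]%classic)%E by [].
  rewrite muF ?(lt_le_trans Mt)// klebE lebE// -EFinM lee_fin.
  by apply: kL => //; exact: lt_le_trans ta.
have h2 : (leb A <= leb (A `&` `]t, c]%classic) + (t - M)%:E)%E.
  rewrite -(lebE (ltW Mt)); apply: le_trans (measureU2 _ _ _) => //.
  apply: le_measure; rewrite ?inE//.
    by apply: measurableU => //; exact: measurable_itv.
  move=> x Ax; have /= := AMc _ Ax; rewrite !in_itv/= => /andP[Mx xc].
  by have [xt|tx] := leP x t; [right|left; split=> //]; rewrite ?Mx.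
apply: (@le_trans _ _ (k%:E * (leb (A `&` `]t, c]%classic) + (t - M)%:E))%E).
  by apply: lee_wpmul2l => //; rewrite lee_fin.
rewrite ge0_muleDr//; last by rewrite lee_fin subr_ge0 ltW.
rewrite leeD// -EFinM lee_fin.
have : t - M <= e / (k + 1).
  by rewrite lerBlDl ge_min lexx orbT.
rewrite ler_pdivlMr// => h; nra.
Qed.

(** A bounded density near x leaves no room for an atom. *)
Lemma concave_after_atomless x : M < x -> mu [set x] = 0%E.
Proof.
move=> Mx.
have Mc : M < (M + x) / 2 by lra.
have [k [k0 _ kR]] := concave_after_density Mc.
apply/eqP; rewrite eq_le measure_ge0 andbT.
apply: le_trans (kR [set x] x _ _) _ => //.
  by move=> y -> /=; rewrite in_itv/= lexx andbT; lra.
by rewrite lebesgue_measure_set1 mule0.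
Qed.

(** The point c may be included on both sides because it carries no mass. *)
Lemma concave_after_density_closed c : M < c ->
  exists k : R, [/\ 0 <= k,
    forall A : set (measurableTypeR R), measurable A ->
      A `<=` `]M, c]%classic ->
      (k%:E * leb A <= mu A)%E &
    forall (A : set (measurableTypeR R)) d, measurable A ->
      A `<=` `[c, d]%classic ->
      (mu A <= k%:E * leb A)%E].
Proof.
move=> Mc; have [k [k0 kL kR]] := concave_after_density Mc.
exists k; split=> // A d mA Acd.
have m1 : measurable ([set c] : set (measurableTypeR R)).
  exact: measurable_set1.
have mAc : measurable (A `\` [set c] : set (measurableTypeR R)).
  exact: measurableD.
apply: (@le_trans _ _ (mu (A `\` [set c]) + mu [set c])%E).
  apply: le_trans (measureU2 _ _ _) => //.
  apply: le_measure; rewrite ?inE//; first exact: measurableU.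
  by move=> x Ax; have [->|/eqP xc] := eqVneq x c; [right|left].
rewrite (concave_after_atomless Mc) adde0.
apply: (@le_trans _ _ (k%:E * leb (A `\` [set c]))%E).
  apply: (kR _ d) => // x [/Acd /= + /eqP xc];
    rewrite !in_itv/= => /andP[cx ->].
  by rewrite lt_neqAle eq_sym xc cx.
apply: lee_wpmul2l; first by rewrite lee_fin.
by apply: le_measure; rewrite ?inE//; exact: subDsetl.
Qed.

End density.

(** * Integrals of quadratic functions *)

Definition quad (R : realType) (p r q x : R) : R := p * x ^+ 2 + r * x + q.

Definition quad_integral (R : realType) (p r q a b : R) : R :=
  p / 3 * (b ^+ 3 - a ^+ 3) + r / 2 * (b ^+ 2 - a ^+ 2) + q * (b - a).

Lemma continuous_quad (R : realType) (p r q : R) : continuous (quad p r q).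
Proof.
move=> x; apply: cvgD; last exact: cvg_cst.
apply: cvgD; apply: cvgM; try exact: cvg_cst; try exact: cvg_id.
exact: exprn_continuous.
Qed.

Lemma integral_quad (R : realType) (p r q a b : R) (s t : bool) : a <= b ->
  (\int[@lebesgue_measure R]_(x in [set` Interval (BSide s a) (BSide t b)])
     (quad p r q x)%:E = (quad_integral p r q a b)%:E)%E.
Proof.
rewrite /quad_integral.
have mq (D : set R) : measurable_fun D (quad p r q).
  apply: measurable_funTS.
  exact: continuous_measurable_fun (@continuous_quad _ _ _ _).
rewrite le_eqVlt => /predU1P[->|ab].
  rewrite integral_itv_bndoo; last by apply/measurable_EFinP; exact: mq.
  rewrite set_itvoo0 integral_set0; congr EFin; ring.
rewrite integral_itv_bndoo; last by apply/measurable_EFinP; exact: mq.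
rewrite -(integral_itv_bndoo true false); last by apply/measurable_EFinP;
  exact: mq.
pose F x : R := p / 3 * x ^+ 3 + r / 2 * x ^+ 2 + q * x.
have dF (x : R) : is_derive x (1 : R) F (quad p r q x).
  by apply: is_derive_eq; rewrite /quad /GRing.scale/=; field.
have cF : continuous F.
  move=> y; apply: differentiable_continuous; apply/derivable1_diffP;
    exact: ex_derive.
rewrite (@continuous_FTC2 _ _ F)//.
- rewrite -EFinB /F; congr EFin; ring.
- exact/continuous_subspaceT/continuous_quad.
- split.
  + by move=> x _; exact: ex_derive.
  + exact/cvg_at_right_filter/cF.
  + exact/cvg_at_left_filter/cF.
- by move=> x _; rewrite derive1E derive_val.
Qed.

Lemma ge0_le_measure_integral_on d (T : measurableType d) (R : realType)
    (m1 m2 : {measure set T -> \bar R}) (D : set T) (f : T -> \bar R) :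
  measurable D -> measurable_fun D f -> (forall x, D x -> 0 <= f x)%E ->
  (forall A, measurable A -> A `<=` D -> m1 A <= m2 A)%E ->
  (\int[m1]_(x in D) f x <= \int[m2]_(x in D) f x)%E.
Proof.
move=> mD mf f0 m12.
have restrE (m : {measure set T -> \bar R}) :
    (\int[m]_(x in D) f x = \int[mrestr m mD]_(x in D) (f \_ D) x)%E.
  rewrite (@eq_measure_integral _ _ _ _ (mrestr m mD)); last first.
    by move=> A mA AD; rewrite /= /mrestr setIidl.
  by apply: eq_integral => x xD; rewrite patchE xD.
rewrite !restrE; apply: ge0_le_measure_integral => //.
- move=> A mA; rewrite /= /mrestr; apply: m12; first exact: measurableI.
  exact: subIsetr.
- by apply: erestrict_ge0.
- by apply/(measurable_restrictT _ mD) => //.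
Qed.

Lemma integral_itv_ge (R : realType)
    (mu : {measure set (measurableTypeR R) -> \bar R}) (f : R -> \bar R)
    (x y z : itv_bound R) (r s : R) :
  @measurable_fun _ _ (measurableTypeR R) (\bar R) setT f ->
  (x <= y)%O -> (y <= z)%O ->
  (r%:E <= \int[mu]_(w in [set` Interval x y]) f w)%E ->
  (s%:E <= \int[mu]_(w in [set` Interval y z]) f w)%E ->
  ((r + s)%:E <= \int[mu]_(w in [set` Interval x z]) f w)%E.
Proof.
move=> mf xy yz hr hs; rewrite (itv_bndbnd_setU xy yz) integral_setU//.
- by rewrite EFinD leeD.
- exact: measurable_funTS.
- apply/disj_setPS => w [] /=; rewrite !itv_boundlr => /andP[_ wy] /andP[yw _].
  by have := le_trans wy yw; rewrite bnd_simp ltxx.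
Qed.

(** Where the test function is nonnegative, a measure bounded below by k
    times Lebesgue measure may be replaced by the latter. *)
Lemma ge_integral_quad_above (R : realType)
    (mu : {measure set (measurableTypeR R) -> \bar R}) (k p r q a b : R)
    (s t : bool) (f : R -> R) (D := [set` Interval (BSide s a) (BSide t b)]) :
  0 <= k -> a <= b ->
  (forall A : set (measurableTypeR R), measurable A -> A `<=` D ->
    (k%:E * lebesgue_measure A <= mu A)%E) ->
  {in D, f =1 quad p r q} -> {in D, forall x, 0 <= quad p r q x} ->
  ((k * quad_integral p r q a b)%:E <= \int[mu]_(x in D) (f x)%:E)%E.
Proof.
move=> k0 ab kmu fE q0.
have mD : measurable (D : set (measurableTypeR R)) by exact: measurable_itv.
have mq (E : set R) : measurable_fun E (quad p r q).
  apply: measurable_funTS.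
  exact: continuous_measurable_fun (@continuous_quad _ _ _ _).
rewrite (@eq_integral _ (measurableTypeR R) R mu D
  (fun x => (quad p r q x)%:E)); last by move=> x xD; rewrite fE.
pose kleb : {measure set (measurableTypeR R) -> \bar R} :=
  mscale (NngNum k0) (@lebesgue_measure R).
have q0' x : D x -> (0 <= (quad p r q x)%:E)%E.
  by move=> Dx; rewrite lee_fin q0// inE.
apply: (@le_trans _ _ (\int[kleb]_(x in D) (quad p r q x)%:E)%E); last first.
  by apply: ge0_le_measure_integral_on => //; apply/measurable_EFinP; exact: mq.
rewrite ge0_integral_mscale//=; last by apply/measurable_EFinP; exact: mq.
by rewrite /D integral_quad.
Qed.

(** Where the test function is nonpositive, an upper bound on the measure has
    the same effect. *)
Lemma ge_integral_quad_below (R : realType)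
    (mu : {measure set (measurableTypeR R) -> \bar R}) (k p r q a b : R)
    (s t : bool) (f : R -> R) (D := [set` Interval (BSide s a) (BSide t b)]) :
  0 <= k -> a <= b ->
  (forall A : set (measurableTypeR R), measurable A -> A `<=` D ->
    (mu A <= k%:E * lebesgue_measure A)%E) ->
  {in D, f =1 quad p r q} -> {in D, forall x, quad p r q x <= 0} ->
  ((k * quad_integral p r q a b)%:E <= \int[mu]_(x in D) (f x)%:E)%E.
Proof.
move=> k0 ab kmu fE q0.
have mD : measurable (D : set (measurableTypeR R)) by exact: measurable_itv.
have mq (E : set R) : measurable_fun E (quad (- p) (- r) (- q)).
  apply: measurable_funTS.
  exact: continuous_measurable_fun (@continuous_quad _ _ _ _).
have quadN x : quad (- p) (- r) (- q) x = - quad p r q x by rewrite /quad; ring.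
rewrite (@eq_integral _ (measurableTypeR R) R mu D
  (fun x => (- (quad (- p) (- r) (- q) x)%:E)%E)); last first.
  by move=> x xD; rewrite fE// quadN EFinN oppeK.
pose kleb : {measure set (measurableTypeR R) -> \bar R} :=
  mscale (NngNum k0) (@lebesgue_measure R).
have q0' x : D x -> (0 <= (quad (- p) (- r) (- q) x)%:E)%E.
  by move=> Dx; rewrite lee_fin quadN oppr_ge0 q0// inE.
rewrite integral_ge0N// leeNr.
apply: (@le_trans _ _ (\int[kleb]_(x in D) (quad (- p) (- r) (- q) x)%:E)%E).
  by apply: ge0_le_measure_integral_on => //; apply/measurable_EFinP; exact: mq.
rewrite ge0_integral_mscale//=; last by apply/measurable_EFinP; exact: mq.
rewrite /D integral_quad// -EFinM lee_fin le_eqVlt; apply/orP; left.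
by apply/eqP; rewrite /quad_integral; ring.
Qed.

(** * The test function *)

(** At m = 0 and m = 1 the root y equals (3 - m) / 2, so replacing y by the
    arithmetic-geometric bound y (3 - m) <= y^2 + (3 - m)^2 / 4 is sharp at
    both ends; after multiplication by 3 - m the remaining slack is
    9 m^2 (1 - m^2). *)
Lemma vp_cubic (R : realType) (m y : R) : 0 <= m -> m <= 1 -> 0 < y ->
  4 * y ^+ 2 = 9 - 5 * m ^+ 2 -> 8 * y ^+ 3 <= 27 - 18 * m ^+ 2 - m ^+ 3.
Proof.
move=> m0 m1 y0 yE.
have yle : y * (2 * (3 - m)) <= 9 - 3 * m - 2 * m ^+ 2.
  have := sqr_ge0 (2 * y - (3 - m)); nra.
have h : 2 * (9 - 5 * m ^+ 2) * (y * (2 * (3 - m))) <=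
    2 * (9 - 5 * m ^+ 2) * (9 - 3 * m - 2 * m ^+ 2).
  by rewrite ler_wpM2l//; nra.
have -> : 8 * y ^+ 3 = 2 * y * (9 - 5 * m ^+ 2) by rewrite -yE; ring.
have m3 : 0 < 3 - m by lra.
rewrite -(ler_pM2r m3).
have m24 : 0 <= m ^+ 2 * (1 - m ^+ 2) by rewrite mulr_ge0 ?sqr_ge0//; nra.
nra.
Qed.

(** The even function 4 x^2 - m^2 is 9 - 6 m^2 times a convex combination of
    4 x^2 / 9, the majorant that is optimal for mode 0, and of
    (4 x^2 - 1) / 3, the one used for modes outside ]-1, 1[.  The weights are
    fixed by the condition that the integral of 4 x^2 - m^2 over [- m, m / 2]
    vanishes. *)
Definition vp_kernel (R : realType) (m x : R) : R :=
  4 * x ^+ 2 - m ^+ 2 - 3 * (3 - 2 * m ^+ 2) * (1 <= `|x|)%R%:R.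

Lemma measurable_norm_ge1 d (T : measurableType d) (R : realType) (X : T -> R) :
  measurable_fun setT X -> measurable [set w | 1 <= `|X w|].
Proof.
move=> mX.
have -> : [set w | 1 <= `|X w|] = (fun w => `|X w|) @^-1` `[1, +oo[%classic.
  by apply/seteqP; split => w; rewrite /= in_itv/= andbT.
rewrite -[X in measurable X]setTI.
by apply: (measurableT_comp (@normr_measurable R setT) mX).
Qed.

Lemma measurable_vp_kernel (R : realType) (m : R) :
  measurable_fun [set: R] (vp_kernel m).
Proof.
apply: measurable_funB; last first.
  apply: measurable_funM => //.
  have -> : (fun x : R => (1 <= `|x|)%R%:R) = (\1_[set x : R | 1 <= `|x|]
    : R -> R).
    by apply/funext => x; rewrite indicE mem_setE.
  apply: measurable_indic.
  exact: measurable_norm_ge1.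
apply: measurable_funB => //.
by apply: measurable_funM => //; exact: exprn_measurable.
Qed.

Section tail.
Context (R : realType).
Context (mu : {finite_measure set (measurableTypeR R) -> \bar R}).
Context (F : R -> R) (M : R).
Hypothesis muF : forall a b : R, M < a -> a <= b ->
  mu `]a, b]%classic = (F b - F a)%:E.
Hypothesis cF : concave_after F M.

Let kernel_in (m x : R) : `|x| < 1 -> vp_kernel m x = quad 4 0 (- m ^+ 2) x.
Proof.
by move=> x1; rewrite /vp_kernel /quad leNgt x1/=; ring.
Qed.

Let kernel_out (m x : R) : 1 <= `|x| ->
  vp_kernel m x = quad 4 0 (- m ^+ 2 - 3 * (3 - 2 * m ^+ 2)) x.
Proof. by move=> x1; rewrite /vp_kernel /quad x1/=; ring. Qed.

Let kernel_far (m x : R) : 9 - 5 * m ^+ 2 <= 4 * x ^+ 2 -> m ^+ 2 <= 1 ->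
  0 <= vp_kernel m x.
Proof.
rewrite /vp_kernel; case: (1 <= `|x|); rewrite ?mulr1 ?mulr0; lra.
Qed.

(** y is the point beyond which the kernel is nonnegative again. *)
Let kernel_root (m : R) : 0 <= m -> m <= 1 ->
  {y : R | [/\ 1 <= y, 4 * y ^+ 2 = 9 - 5 * m ^+ 2 &
               8 * y ^+ 3 <= 27 - 18 * m ^+ 2 - m ^+ 3]}.
Proof.
move=> m0 m1; exists (Num.sqrt ((9 - 5 * m ^+ 2) / 4)).
have m21 : m ^+ 2 <= 1 by rewrite expr_le1.
have yE : 4 * Num.sqrt ((9 - 5 * m ^+ 2) / 4) ^+ 2 = 9 - 5 * m ^+ 2.
  by rewrite sqr_sqrtr; [field|lra].
have y1 : 1 <= Num.sqrt ((9 - 5 * m ^+ 2) / 4).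
  by rewrite -{1}sqrtr1 ler_wsqrtr//; lra.
by split => //; apply: vp_cubic => //; lra.
Qed.

(** The kernel is nonnegative on ]M, 1[, nonpositive on [1, y] and
    nonnegative beyond, so one comparison slope, taken at 1, suffices. *)
Let vp_tail_mode_pos : 0 <= M -> M < 1 ->
  (0 <= \int[mu]_(x in `]M, +oo[) (vp_kernel M x)%:E)%E.
Proof.
move=> M0 M1; have [y [y1 yE ycub]] := kernel_root M0 (ltW M1).
have M21 : M ^+ 2 <= 1 by rewrite expr_le1// ltW.
have [k [k0 kL kR]] := concave_after_density_closed muF cF M1.
have mK : @measurable_fun _ _ (measurableTypeR R) (\bar R) setT
    (fun x => (vp_kernel M x)%:E).
  by apply/measurable_EFinP; exact: measurable_vp_kernel.
have I1 : ((k * quad_integral 4 0 (- M ^+ 2) M 1)%:E <=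
    \int[mu]_(x in `]M, 1%R[) (vp_kernel M x)%:E)%E.
  apply: (ge_integral_quad_above k0 (ltW M1)) => [A mA AM1|x|x].
  - apply: kL => // x /AM1/=; rewrite !in_itv/= => /andP[-> /ltW ->//].
  - rewrite inE/= in_itv/= => /andP[Mx x1]; apply: kernel_in.
    by rewrite ltr_norml; apply/andP; split; lra.
  - rewrite inE/= in_itv/= => /andP[Mx x1]; rewrite /quad; nra.
have I2 : ((k * quad_integral 4 0 (- M ^+ 2 - 3 * (3 - 2 * M ^+ 2)) 1 y)%:E <=
    \int[mu]_(x in `[1%R, y]) (vp_kernel M x)%:E)%E.
  apply: (ge_integral_quad_below k0 y1) => [A mA A1y|x|x].
  - exact: (kR _ y).
  - rewrite inE/= in_itv/= => /andP[x1 xy]; apply: kernel_out.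
    by rewrite ger0_norm//; lra.
  - rewrite inE/= in_itv/= => /andP[x1 xy]; rewrite /quad; nra.
have I3 : (0%:E <= \int[mu]_(x in `]y, +oo[) (vp_kernel M x)%:E)%E.
  apply: integral_ge0 => x /=; rewrite in_itv/= andbT => yx; rewrite lee_fin.
  by apply: kernel_far => //; nra.
apply: le_trans
  (integral_itv_ge mK _ _ I1 (integral_itv_ge mK _ _ I2 I3));
  rewrite ?bnd_simp//.
rewrite lee_fin addr0 -mulrDr mulr_ge0// /quad_integral; nra.
Qed.

(** Here the kernel has an additional dip on [- m / 2, m / 2].  The slope k
    at - m / 2 handles the mass on ]- m, m / 2], the slope l at 1 the mass on
    ]m / 2, y].  The first contribution vanishes since 4 x^2 - m^2 integrates
    to 0 over [- m, m / 2]. *)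
Let vp_tail_mode_neg (m := Num.min (- M) 1) : M < 0 ->
  (0 <= \int[mu]_(x in `]M, +oo[) (vp_kernel m x)%:E)%E.
Proof.
move=> M0.
have m0 : 0 < m by rewrite lt_min; lra.
have m1 : m <= 1 by rewrite ge_min lexx orbT.
have Mm : M <= - m by rewrite lerNr ge_min lexx.
have [y [y1 yE ycub]] := kernel_root (ltW m0) m1.
have m21 : m ^+ 2 <= 1 by rewrite expr_le1// ltW.
have Mm2 : M < - (m / 2) by lra.
have M1 : M < 1 by lra.
have [k [k0 kL kR]] := concave_after_density_closed muF cF Mm2.
have [l [l0 lL lR]] := concave_after_density_closed muF cF M1.
have mK : @measurable_fun _ _ (measurableTypeR R) (\bar R) setT
    (fun x => (vp_kernel m x)%:E).
  by apply/measurable_EFinP; exact: measurable_vp_kernel.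
have hm1 : - m <= - (m / 2) by lra.
have hm2 : - (m / 2) <= m / 2 by lra.
have hm3 : m / 2 < 1 by lra.
have kin x : - m < x -> x < 1 -> vp_kernel m x = quad 4 0 (- m ^+ 2) x.
  by move=> mx x1; apply: kernel_in; rewrite ltr_norml; apply/andP; split; lra.
have I0 : (0%:E <= \int[mu]_(x in `]M, (- m)%R]) (vp_kernel m x)%:E)%E.
  apply: integral_ge0 => x /=; rewrite in_itv/= => /andP[Mx xm].
  (* Such an x exists only for M < - m, that is for M < -1. *)
  have m1E : m = 1.
    by have := lt_le_trans Mx xm; rewrite /m; case: (leP (- M) 1) => //; lra.
  by rewrite lee_fin; apply: kernel_far => //; rewrite m1E in xm *; nra.
have I1 : ((k * quad_integral 4 0 (- m ^+ 2) (- m) (- (m / 2)))%:E <=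
    \int[mu]_(x in `](- m)%R, (- (m / 2))%R]) (vp_kernel m x)%:E)%E.
  apply: (ge_integral_quad_above k0 hm1) => [A mA AM|x|x].
  - apply: kL => // x /AM/=; rewrite !in_itv/= => /andP[mx ->].
    by rewrite (le_lt_trans Mm).
  - by rewrite inE/= in_itv/= => /andP[mx xm]; apply: kin; lra.
  - rewrite inE/= in_itv/= => /andP[mx xm].
    by rewrite /quad; nra.
have I2 : ((k * quad_integral 4 0 (- m ^+ 2) (- (m / 2)) (m / 2))%:E <=
    \int[mu]_(x in `](- (m / 2))%R, (m / 2)%R]) (vp_kernel m x)%:E)%E.
  apply: (ge_integral_quad_below k0 hm2) => [A mA AM|x|x].
  - apply: (kR _ (m / 2)) => // x /AM/=; rewrite !in_itv/= => /andP[mx ->].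
    by rewrite ltW.
  - by rewrite inE/= in_itv/= => /andP[mx xm]; apply: kin; lra.
  - rewrite inE/= in_itv/= => /andP[mx xm].
    by rewrite /quad; nra.
have I3 : ((l * quad_integral 4 0 (- m ^+ 2) (m / 2) 1)%:E <=
    \int[mu]_(x in `](m / 2)%R, 1%R[) (vp_kernel m x)%:E)%E.
  apply: (ge_integral_quad_above l0 (ltW hm3)) => [A mA AM|x|x].
  - apply: lL => // x /AM/=; rewrite !in_itv/= => /andP[mx /ltW ->].
    by rewrite andbT; lra.
  - by rewrite inE/= in_itv/= => /andP[mx xm]; apply: kin; lra.
  - rewrite inE/= in_itv/= => /andP[mx xm].
    by rewrite /quad; nra.
have I4 : ((l * quad_integral 4 0 (- m ^+ 2 - 3 * (3 - 2 * m ^+ 2)) 1 y)%:E <=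
    \int[mu]_(x in `[1%R, y]) (vp_kernel m x)%:E)%E.
  apply: (ge_integral_quad_below l0 y1) => [A mA AM|x|x].
  - exact: (lR _ y).
  - rewrite inE/= in_itv/= => /andP[x1 xy]; apply: kernel_out.
    by rewrite ger0_norm//; lra.
  - rewrite inE/= in_itv/= => /andP[x1 xy].
    by rewrite /quad; nra.
have I5 : (0%:E <= \int[mu]_(x in `]y, +oo[) (vp_kernel m x)%:E)%E.
  apply: integral_ge0 => x /=; rewrite in_itv/= andbT => yx; rewrite lee_fin.
  by apply: kernel_far => //; nra.
apply: le_trans (integral_itv_ge mK _ _ I0 (integral_itv_ge mK _ _ I1
  (integral_itv_ge mK _ _ I2 (integral_itv_ge mK _ _ I3
    (integral_itv_ge mK _ _ I4 I5))))); rewrite ?bnd_simp//.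
have m3 : 0 <= m ^+ 3 by rewrite exprn_ge0// ltW.
set K1 := k * _; set K2 := k * _; set L1 := l * _; set L2 := l * _.
(* K1 and K2 cancel; the last summand on the right is 0 by the choice of y. *)
have -> : 0 + (K1 + (K2 + (L1 + (L2 + 0)))) =
    l / 3 * (27 - 18 * m ^+ 2 + m ^+ 3 - 8 * y ^+ 3 +
             (4 * y ^+ 2 - (9 - 5 * m ^+ 2)) * (3 * y)).
  by rewrite /K1 /K2 /L1 /L2 /quad_integral; field.
by rewrite lee_fin yE subrr mul0r mulr_ge0 ?divr_ge0//; lra.
Qed.

Lemma vp_tail (m := Num.min `|M| 1) :
  (0 <= \int[mu]_(x in `]M, +oo[) (vp_kernel m x)%:E)%E.
Proof.
rewrite /m; have [M0|M0] := ltP M 0; first by rewrite ltr0_norm//;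
  exact: vp_tail_mode_neg.
rewrite ger0_norm//; have [M1|M1] := leP M 1; last first.
  apply: integral_ge0 => x /=; rewrite in_itv/= andbT => yx; rewrite lee_fin.
  by apply: kernel_far; nra.
move: M1; rewrite le_eqVlt => /predU1P[M1|M1]; last exact: vp_tail_mode_pos.
apply: integral_ge0 => x /=; rewrite in_itv/= andbT => yx; rewrite lee_fin.
by apply: kernel_far; nra.
Qed.

End tail.

(** * The inequality of Vysochanskii and Petunin *)

(** The three-point form makes affine changes of variable immediate. *)
Lemma convex_functionP (R : realType) (D : set R) (G : R -> R) :
  convex_function D G <->
  (forall a b d, D a -> D d -> a < b -> b < d ->
    G b * (d - a) <= G a * (d - b) + G d * (b - a)).
Proof.
split=> [cG a b d Da Dd ab bd|cG t x y].
  have ad : 0 < d - a by lra.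
  have t0 : 0 <= (d - b) / (d - a) by rewrite divr_ge0//; lra.
  have t1 : (d - b) / (d - a) <= 1 by rewrite ler_pdivrMr//; lra.
  have := cG (Itv01 t0 t1) a d (mem_set Da) (mem_set Dd).
  rewrite !convRE /= => /(ler_wpM2r (ltW ad)).
  rewrite /unstable.onem.
  have cE : (d - b) / (d - a) * a + (1 - (d - b) / (d - a)) * d = b by field;
    lra.
  rewrite [X in G X](_ : _ = b); last exact: cE.
  move=> h; apply: le_trans h _.
  by rewrite le_eqVlt; apply/orP; left; apply/eqP; field; lra.
rewrite !inE => Dx Dy.
have t0 : 0 <= t%:num by [].
have t1 : t%:num <= 1 by [].
rewrite [X in G X](_
  : _ = t%:num * x + (1 - t%:num) * y)// [leRHS]convRE /unstable.onem.
have [xy|yx|<-] := ltgtP x y; last first.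
- have e (u : R) : t%:num * u + (1 - t%:num) * u = u by ring.
  by rewrite !e.
- have [->|tn0] := eqVneq t%:num 0; first by rewrite !mul0r !add0r subr0 !mul1r.
  have [->|tn1] := eqVneq t%:num 1; first by rewrite !mul1r subrr !mul0r !addr0.
  have lt0 : 0 < t%:num by rewrite lt_neqAle eq_sym tn0.
  have lt1 : t%:num < 1 by rewrite lt_neqAle tn1.
  have := cG y (t%:num * x + (1 - t%:num) * y) x Dy Dx.
  move=> /(_ _ _) h; rewrite -(@ler_pM2r _ (x - y)) ?subr_gt0//.
  apply: le_trans (h _ _) _; [nra|nra|].
  by rewrite le_eqVlt; apply/orP; left; apply/eqP; ring.
- have [->|tn0] := eqVneq t%:num 0; first by rewrite !mul0r !add0r subr0 !mul1r.
  have [->|tn1] := eqVneq t%:num 1; first by rewrite !mul1r subrr !mul0r !addr0.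
  have lt0 : 0 < t%:num by rewrite lt_neqAle eq_sym tn0.
  have lt1 : t%:num < 1 by rewrite lt_neqAle tn1.
  have := cG x (t%:num * x + (1 - t%:num) * y) y Dx Dy.
  move=> /(_ _ _) h; rewrite -(@ler_pM2r _ (y - x)) ?subr_gt0//.
  apply: le_trans (h _ _) _; [nra|nra|].
  by rewrite le_eqVlt; apply/orP; left; apply/eqP; ring.
Qed.

(** The tail estimate for a random variable; stated for X : T -> R so that it
    applies both to the standardized variable and to its opposite. *)
Lemma vp_half d (T : measurableType d) (R : realType) (P : probability T R)
    (X : T -> R) (F : R -> R) (M : R) (m := Num.min `|M| 1) :
  measurable_fun setT X ->
  (forall a b, M < a -> a <= b -> P (X @^-1` `]a, b]) = (F b - F a)%:E) ->
  concave_after F M ->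
  P.-integrable setT (fun w => (vp_kernel m (X w))%:E) ->
  (0 <= \int[P]_(w in X @^-1` `]M, +oo[) (vp_kernel m (X w))%:E)%E.
Proof.
move=> mX PF cF iK.
pose Xm := isMeasurableFun.Build _ _ T (measurableTypeR R) X mX.
pose Xr : {mfun T >-> measurableTypeR R} := HB.pack X Xm.
have := @vp_tail R (distribution P Xr) F M PF cF.
rewrite /distribution integral_pushforward//; first last.
- apply: (integrableS measurableT) => //; rewrite -[X in measurable X]setTI.
  by apply: (mX) => //; exact: measurable_itv.
- by apply/measurable_EFinP; exact: measurable_vp_kernel.
Qed.

Lemma integral_vp_kernel d (T : measurableType d) (R : realType)
    (P : probability T R) (X : T -> R) (m S p : R) :
  measurable_fun setT X ->
  P.-integrable setT (fun w => (X w ^+ 2)%:E) ->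
  (\int[P]_w (X w ^+ 2)%:E = S%:E)%E ->
  P [set w | 1 <= `|X w|] = p%:E ->
  P.-integrable setT (fun w => (vp_kernel m (X w))%:E) /\
  (\int[P]_w (vp_kernel m (X w))%:E =
    (4 * S - m ^+ 2 - 3 * (3 - 2 * m ^+ 2) * p)%:E)%E.
Proof.
move=> mX iX2 X2 PA.
pose A := [set w | 1 <= `|X w|]; pose D : R := 3 * (3 - 2 * m ^+ 2).
have mA : measurable A by exact: measurable_norm_ge1.
have i1 : P.-integrable setT (fun w => (4 * X w ^+ 2)%:E).
  by under eq_fun do rewrite EFinM; exact: integrableZl.
have i2 : P.-integrable setT (fun w => (m ^+ 2)%:E).
  exact: (finite_measure_integrable_cst P (m ^+ 2) measurableT).
have i3' : P.-integrable setT (fun w => (\1_A w)%:E) by exact: integrable_indic.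
have i3 : P.-integrable setT (fun w => (D * \1_A w)%:E).
  by under eq_fun do rewrite EFinM; exact: integrableZl.
have i12 : P.-integrable setT (fun w => (4 * X w ^+ 2 - m ^+ 2)%:E).
  by under eq_fun do rewrite EFinB; exact: integrableB.
have KE : (fun w => (vp_kernel m (X w))%:E) =
    (fun w => (4 * X w ^+ 2 - m ^+ 2)%:E - (D * \1_A w)%:E)%E.
  by apply/funext => w; rewrite -EFinB /vp_kernel indicE mem_setE.
rewrite KE; split; first exact: integrableB.
rewrite integralB_EFin//.
under eq_integral do rewrite EFinB.
rewrite integralB_EFin//.
under eq_integral do rewrite EFinM.
rewrite integralZl//= X2 integral_cst//= probability_setT mule1.
under eq_integral do rewrite EFinM.
by rewrite integralZl//= integral_indic// setIT [X in (_ - _ * X)%E](_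
  : _ = p%:E)// -!EFinM.
Qed.

Lemma cdf_itv d (T : measurableType d) (R : realType) (P : probability T R)
    (Z : {RV P >-> R}) (a b : R) : a <= b ->
  P (Z @^-1` `]a, b]%classic) = (fine (cdf Z b) - fine (cdf Z a))%:E.
Proof.
move=> ab; rewrite EFinB !fineK ?fin_num_measure//.
rewrite /cdf /distribution /pushforward.
have -> : `]a, b]%classic = `]-oo, b] `\` `]-oo, a] :> set R.
  by rewrite -[RHS]setCK setCD setCitvl setUC -[LHS]setCK setCitv.
have -> : Z @^-1` (`]-oo, b] `\` `]-oo, a]) =
    Z @^-1` `]-oo, b] `\` Z @^-1` `]-oo, a] by [].
rewrite measureD ?setIidr//.
- by apply: preimage_subset; exact: subset_itvl.
- exact: measurable_funPTI.
- exact: measurable_funPTI.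
- by rewrite -ge0_fin_numE// fin_num_measure//; exact: measurable_funPTI.
Qed.

Section unimodal.
Context d (T : measurableType d) (R : realType) (P : probability T R).
Context (Z : {RV P >-> R}) (M : R).
Hypothesis Zunimodal : unimodal_at Z M.
Let F x : R := fine (cdf Z x).

Let mZ (A : set R) : measurable A -> measurable (Z @^-1` A).
Proof. by move=> mA; rewrite -[X in measurable X]setTI;
  exact: measurable_funP. Qed.

Let F01 x : 0 <= F x /\ F x <= 1.
Proof.
split; first exact: fine_ge0.
by rewrite -lee_fin fineK ?fin_num_measure//; exact: cdf_le1.
Qed.

(** A convex function is Lipschitz near interior points of its domain. *)
Lemma unimodal_atomless x : x < M -> P (Z @^-1` [set x]) = 0%E.
Proof.
move=> xM; have [/convex_functionP cF _] := Zunimodal.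
have m1 : measurable (Z @^-1` [set x]) by exact: mZ.
rewrite -[LHS]fineK ?fin_num_measure//; congr EFin.
set p := fine _; have p0 : 0 <= p by exact: fine_ge0.
pose e := (M - x) / 2.
have e0 : 0 < e by rewrite /e; lra.
have pF t : t < x -> p <= F x - F t.
  move=> tx; rewrite -lee_fin /p fineK ?fin_num_measure// -cdf_itv;
    last exact: ltW.
  apply: le_measure; rewrite ?inE//; first exact: mZ.
  by move=> w /= ->; rewrite in_itv/= tx lexx.
have pe t : t < x -> p * e <= x - t.
  move=> tx; have tM := lt_trans tx xM.
  have := cF t x (x + e); rewrite /= !in_itv/= => /(_ tM _ tx _) h.
  have {h} : F x * (x + e - t) <= F t * (x + e - x) + F (x + e) * (x - t).
    by apply: h; rewrite /e; lra.
  have := pF t tx; have [] := F01 (x + e); have [] := F01 x; have [] := F01 t;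
    nra.
apply/eqP; rewrite eq_le p0 andbT leNgt; apply/negP => pgt.
have pe0 : 0 < p * e by rewrite mulr_gt0.
have := pe (x - p * e / 2); lra.
Qed.

Lemma unimodal_right_concave (c k : R) : 0 < k ->
  concave_after (fun x => F (c + k * x)) ((M - c) / k).
Proof.
move=> k0 x y z Mx xy yz; have [_ /convex_functionP cF] := Zunimodal.
have Mx' : M < c + k * x by move: Mx; rewrite ltr_pdivrMr//; lra.
have xy' : c + k * x < c + k * y by rewrite ltrD2l ltr_pM2l.
have yz' : c + k * y < c + k * z by rewrite ltrD2l ltr_pM2l.
have := cF _ _ (c + k * z) _ _ xy' yz'; rewrite /= !in_itv/= !andbT.
move=> /(_ (ltW Mx') (ltW (lt_trans Mx' (lt_trans xy' yz')))).
rewrite -/(F _) -/(F _) -/(F _) => h.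
rewrite -(ler_pM2l k0); nra.
Qed.

(** Up to an additive constant this is the distribution function of the
    reflected variable - (Z - c) / k, to the right of its mode. *)
Lemma unimodal_left_concave (c k : R) : 0 < k ->
  concave_after (fun x => - F (c - k * x)) (- ((M - c) / k)).
Proof.
move=> k0 x y z Mx xy yz; have [/convex_functionP cF _] := Zunimodal.
have Mx' : c - k * x < M.
  by move: Mx; rewrite ltrNl ltr_pdivlMr//; lra.
have xy' : c - k * y < c - k * x by rewrite ltrD2l ltrN2 ltr_pM2l.
have yz' : c - k * z < c - k * y by rewrite ltrD2l ltrN2 ltr_pM2l.
have := cF (c - k * z) _ _ _ _ yz' xy'; rewrite /= !in_itv/=.
move=> /(_ (lt_trans yz' (lt_trans xy' Mx')) Mx').
rewrite -/(F _) -/(F _) -/(F _) => h.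
rewrite -(ler_pM2l k0); nra.
Qed.

(** Half-open intervals of the other orientation, needed for the reflected
    variable; both orientations agree in the absence of atoms. *)
Lemma unimodal_itv_co (a b : R) : a <= b -> b < M ->
  P (Z @^-1` `[a, b[%classic) = (F b - F a)%:E.
Proof.
move=> ab bM; rewrite -cdf_itv//.
have [->|abn] := eqVneq a b; first by rewrite set_itvoc0 set_itvco0.
have ltab : a < b by rewrite lt_neqAle abn.
have h1 : P (Z @^-1` `[a, b]%classic) = P (Z @^-1` `[a, b[%classic).
  rewrite -(setUitv1 true) ?bnd_simp// preimage_setU measureU//.
  - by rewrite [X in (_ + X)%E](unimodal_atomless bM) adde0.
  - exact: mZ.
  - by apply/seteqP; split => // w /= []; rewrite in_itv/= => /andP[_ +] wb;
      rewrite wb ltxx.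
have h2 : P (Z @^-1` `[a, b]%classic) = P (Z @^-1` `]a, b]%classic).
  rewrite -(setU1itv false) ?bnd_simp// preimage_setU measureU//.
  - by rewrite [X in (X + _)%E](unimodal_atomless (lt_trans ltab bM)) add0e.
  - exact: mZ.
  - by apply/seteqP; split => // w /= [wa]; rewrite in_itv/= wa ltxx.
by rewrite -h1 h2.
Qed.

(** The mass to the right of the mode is treated by [vp_half] for X, the mass
    to the left by [vp_half] for - X, and the possible atom at the mode
    contributes g (N) >= 0. *)
Lemma vysochanskii_petunin (c k s : R) : 0 < k ->
  P.-integrable setT (fun w => ((Z w - c) ^+ 2)%:E) ->
  (\int[P]_w ((Z w - c) ^+ 2)%:E = s%:E)%E -> 8 * s <= 3 * k ^+ 2 ->
  (P [set w | (k <= `|Z w - c|)%R] <= (4 * s / (9 * k ^+ 2))%:E)%E.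
Proof.
move=> k0 iZ Zs sk.
pose X w := (Z w - c) / k; pose N := (M - c) / k; pose m := Num.min `|N| 1.
have mX : measurable_fun setT X.
  by apply: measurable_funM => //; apply: measurable_funB => //;
    exact: measurable_funP.
have mNX : measurable_fun setT (fun w => - X w) by exact: measurableT_comp.
have k20 : 0 < k ^+ 2 by rewrite exprn_gt0.
have X2E w : ((X w ^+ 2)%:E = (k ^- 2)%:E * ((Z w - c) ^+ 2)%:E)%E.
  by rewrite -EFinM /X expr_div_n mulrC.
have iX : P.-integrable setT (fun w => (X w ^+ 2)%:E).
  by under eq_fun do rewrite X2E; exact: integrableZl.
have X2 : (\int[P]_w (X w ^+ 2)%:E = (s / k ^+ 2)%:E)%E.
  by under eq_integral do rewrite X2E; rewrite integralZl// Zs -EFinM mulrC.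
have setE : [set w | (k <= `|Z w - c|)%R] = [set w | (1 <= `|X w|)%R].
  apply/seteqP; split => w /=;
    rewrite normrM normfV (gtr0_norm k0) ler_pdivlMr ?mul1r//.
set A := [set w | _] in setE *; pose p := fine (P A).
have mA : measurable A by rewrite setE; exact: measurable_norm_ge1.
have PA : P [set w | 1 <= `|X w|] = p%:E
  by rewrite -setE fineK// fin_num_measure.
have [iK KE] := integral_vp_kernel m mX iX X2 PA.
have KN x : vp_kernel m (- x) = vp_kernel m x
  by rewrite /vp_kernel sqrrN normrN.
have right_ge0 :
    (0 <= \int[P]_(w in X @^-1` `]N, +oo[) (vp_kernel m (X w))%:E)%E.
  apply: (@vp_half _ _ _ _ _ (fun x => F (c + k * x))) => //;
    last exact: unimodal_right_concave.
  move=> a b Na ab; rewrite -cdf_itv ?lerD2l ?ler_pM2l//; congr (P _).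
  apply/seteqP; split => w; rewrite /= !in_itv/= ltr_pdivlMr// ler_pdivrMr//;
    lra.
have left_ge0 :
    (0 <= \int[P]_(w in X @^-1` `]-oo, N[) (vp_kernel m (X w))%:E)%E.
  have := @vp_half _ _ _ P _ (fun x => - F (c - k * x)) (- N) mNX _
    (@unimodal_left_concave c k k0).
  rewrite normrN -/m.
  have -> : (fun w => (vp_kernel m (- X w))%:E) =
      (fun w => (vp_kernel m (X w))%:E).
    by apply/funext => w; rewrite KN.
  have -> : (fun w => - X w) @^-1` `]- N, +oo[%classic =
      X @^-1` `]-oo, N[%classic.
    by apply/seteqP; split => w; rewrite /= !in_itv/= ?andbT ltrN2.
  apply => // a b Na ab.
  have NM : c - k * a < M by move: Na; rewrite ltrNl ltr_pdivlMr//; lra.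
  rewrite opprK addrC -unimodal_itv_co//; last by rewrite lerD2l lerN2 ler_pM2l.
  congr (P _); apply/seteqP; split => w;
    rewrite /= !in_itv/= ltrNr lerNl ltr_pdivrMr// ler_pdivlMr//; lra.
have mid_ge0 : (0 <= \int[P]_(w in X @^-1` [set N]) (vp_kernel m (X w))%:E)%E.
  apply: integral_ge0 => w /= ->; rewrite lee_fin /vp_kernel /m.
  rewrite -(@real_normK _ N) ?num_real//.
  have := normr_ge0 N; case: (leP `|N| 1) => N1 N0; last by rewrite (ltW N1)/=;
    nra.
  move: N1; rewrite le_eqVlt => /predU1P[->|N1]; first by rewrite lexx/=; lra.
  by rewrite [1 <= _]leNgt N1/=; nra.
have mXA (B : set R) : measurable B -> measurable (X @^-1` B).
  by move=> mB; rewrite -[X in measurable X]setTI; exact: mX.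
have tot_ge0 : (0 <= \int[P]_w (vp_kernel m (X w))%:E)%E.
  have mK : measurable_fun setT (fun w => (vp_kernel m (X w))%:E).
    exact: (measurable_int P).
  have -> : [set: T] = X @^-1` `]-oo, N[%classic `|`
    (X @^-1` [set N] `|` X @^-1` `]N, +oo[%classic).
    apply/seteqP; split => // w _ /=; rewrite !in_itv/= andbT.
    by case: (ltgtP (X w) N) => h; [left|right; right|right; left].
  rewrite !integral_setU//.
  - by rewrite adde_ge0// adde_ge0.
  - exact: mXA.
  - exact: mXA.
  - exact: measurable_funTS.
  - by apply/disj_setPS => w [/= ->]; rewrite in_itv/= ltxx.
  - exact: mXA.
  - by apply: measurableU; exact: mXA.
  - exact: measurable_funTS.
  - apply/disj_setPS => w [/=]; rewrite !in_itv/= andbT => h [h'|];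
      first by rewrite h' ltxx in h.
    by move=> /(lt_trans h); rewrite ltxx.
rewrite KE lee_fin in tot_ge0.
have -> : P A = p%:E by rewrite setE.
rewrite lee_fin.
have m0 : 0 <= m ^+ 2 by exact: sqr_ge0.
have m_ge0 : 0 <= m by rewrite /m le_min normr_ge0/=.
have m1 : m ^+ 2 <= 1 by rewrite expr_le1// /m ge_min lexx orbT.
have -> : 4 * s / (9 * k ^+ 2) = 4 / 9 * (s / k ^+ 2) by field; lra.
have S3 : 8 * (s / k ^+ 2) <= 3 by rewrite mulrA ler_pdivrMr.
clear - tot_ge0 m0 m1 S3.
move: (s / k ^+ 2) (m ^+ 2) tot_ge0 m0 m1 S3 => S n h n0 n1 S3.
have D0 : 0 < 3 - 2 * n by lra.
rewrite -(ler_pM2r D0); nra.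
Qed.

End unimodal.

(** * The upper bounds *)

Section moments.
Context d (T : measurableType d) (R : realType) (P : probability T R).
Context (Z : {RV P >-> R}).

Let mZ : measurable_fun setT (Z : T -> R). Proof. exact: measurable_funP. Qed.

Lemma variance_centered : ('E_P[Z] = 0 -> 'V_P[Z] = \int[P]_w (Z w ^+ 2)%:E)%E.
Proof.
move=> E0; rewrite /variance unlock E0/= unlock; apply: eq_integral => w _.
by rewrite expr2; congr (_ * _)%:E; rewrite /= subr0.
Qed.

Lemma integrable_sqr (r : R) : (\int[P]_w (Z w ^+ 2)%:E = r%:E)%E ->
  P.-integrable setT (fun w => (Z w ^+ 2)%:E).
Proof.
move=> Zr; apply/integrableP; split.
  by apply/measurable_EFinP; exact: measurable_funX.
under eq_integral do rewrite gee0_abs ?lee_fin ?sqr_ge0//.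
by rewrite Zr ltry.
Qed.

Lemma integrable_of_sqr : P.-integrable setT (fun w => (Z w ^+ 2)%:E) ->
  P.-integrable setT (fun w => (Z w)%:E).
Proof.
move=> iZ2.
have i1 : P.-integrable setT (fun w => 1%:E).
  exact: (finite_measure_integrable_cst P 1 measurableT).
apply: (le_integrable measurableT _ _ (integrableD measurableT i1 iZ2)).
  exact/measurable_EFinP.
move=> w _ /=; rewrite lee_fin [leRHS]ger0_norm; last first.
  by rewrite addr_ge0// sqr_ge0.
by have := sqr_ge0 (`|Z w| - 1); rewrite -(real_normK (num_real (Z w))); nra.
Qed.

Lemma integral_sqrB (m s c : R) : P.-integrable setT (fun w => (Z w ^+ 2)%:E) ->
  (\int[P]_w (Z w)%:E = m%:E)%E -> (\int[P]_w (Z w ^+ 2)%:E = s%:E)%E ->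
  P.-integrable setT (fun w => ((Z w - c) ^+ 2)%:E) /\
  (\int[P]_w ((Z w - c) ^+ 2)%:E = (s - 2 * c * m + c ^+ 2)%:E)%E.
Proof.
move=> iZ2 Zm Zs; have iZ := integrable_of_sqr iZ2.
have i1 : P.-integrable setT (fun w => (c ^+ 2)%:E).
  exact: (finite_measure_integrable_cst P (c ^+ 2) measurableT).
have i2 : P.-integrable setT (fun w => (2 * c * Z w)%:E).
  by under eq_fun do rewrite EFinM; exact: integrableZl.
have i3 : P.-integrable setT (fun w => (Z w ^+ 2 - 2 * c * Z w)%:E).
  by under eq_fun do rewrite EFinB; exact: integrableB.
have ZE : (fun w => ((Z w - c) ^+ 2)%:E) =
    (fun w => (Z w ^+ 2 - 2 * c * Z w)%:E + (c ^+ 2)%:E)%E.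
  by apply/funext => w; rewrite -EFinD; congr EFin; ring.
rewrite ZE; split; first exact: integrableD.
rewrite integralD//=.
under eq_integral do rewrite EFinB.
rewrite integralB_EFin// Zs integral_cst//= probability_setT mule1.
under eq_integral do rewrite EFinM.
by rewrite integralZl// Zm -EFinM.
Qed.

Lemma standard_unimodal_sqrB (c : R) : standard_unimodal Z ->
  P.-integrable setT (fun w => ((Z w - c) ^+ 2)%:E) /\
  (\int[P]_w ((Z w - c) ^+ 2)%:E = (1 + c ^+ 2)%:E)%E.
Proof.
move=> [_ E0 V1]; rewrite variance_centered// in V1.
have iZ2 := integrable_sqr V1.
rewrite unlock in E0.
by have := integral_sqrB c iZ2 E0 V1; rewrite mulr0 subr0.
Qed.

(** The mean is recovered from the nonnegative functions Z^2 and (Z + 1)^2,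
    so that no integral of a signed function has to be computed. *)
Lemma standard_unimodalP : (exists M, unimodal_at Z M) ->
  (\int[P]_w (Z w ^+ 2)%:E = 1%:E)%E ->
  (\int[P]_w ((Z w + 1) ^+ 2)%:E = 2%:E)%E ->
  standard_unimodal Z.
Proof.
move=> uZ Z2 Z12; have iZ2 := integrable_sqr Z2.
have iZ := integrable_of_sqr iZ2.
have [m Zm] : exists m, (\int[P]_w (Z w)%:E = m%:E)%E.
  by exists (fine (\int[P]_w (Z w)%:E)); rewrite fineK//;
    exact: integrable_fin_num.
have := (integral_sqrB (-1) iZ2 Zm Z2).2.
under eq_integral do rewrite opprK; rewrite Z12 => -[mE].
have m0 : m = 0 by lra.
have E0 : ('E_P[Z] = 0)%E by rewrite unlock Zm m0.
by split => //; rewrite variance_centered.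
Qed.

End moments.

(** The centre c and the half-width k are free; the two bounds of the theorem
    differ only in their choice. *)
Lemma outside_prob_le d (T : measurableType d) (R : realType)
    (P : probability T R) (Z : {RV P >-> R}) (u v c k : R)
      : standard_unimodal Z ->
  0 < k -> 8 * (1 + c ^+ 2) <= 3 * k ^+ 2 -> c + k <= v -> k - c <= u ->
  (outside_prob u v Z <= (4 * (1 + c ^+ 2) / (9 * k ^+ 2))%:E)%E.
Proof.
move=> sZ k0 ck cv cu; have [iZ Zs] := standard_unimodal_sqrB c sZ.
have [[M uZ] _ _] := sZ.
apply: le_trans (vysochanskii_petunin uZ k0 iZ Zs ck).
have mZ (A : set R) : measurable A -> measurable (Z @^-1` A).
  by move=> mA; exact: measurable_funPTI.
apply: le_measure; rewrite ?inE.
- have -> : [set w | Z w <= - u \/ v <= Z w] =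
      Z @^-1` (`]-oo, - u]%classic `|` `[v, +oo[%classic).
    by apply/seteqP; split => w /=; rewrite !in_itv/= andbT.
  by apply: mZ; apply: measurableU.
- have -> : [set w | k <= `|Z w - c|] =
      Z @^-1` (`]-oo, c - k]%classic `|` `[c + k, +oo[%classic).
    apply/seteqP; split => w /=; rewrite !in_itv/= andbT.
      by rewrite ler_normr => /orP[h|h]; [right|left]; lra.
    by move=> h; rewrite ler_normr; apply/orP; case: h => h; [right|left]; lra.
  by apply: mZ; apply: measurableU.
- by move=> w /= h; rewrite ler_normr; apply/orP; case: h => h; [right|left];
    lra.
Qed.

Lemma sqrt3_le (R : realType) (v : R) : Num.sqrt 3 <= v -> 0 < v /\ 3 <= v ^+ 2.
Proof.
move=> hv; have s3 : 0 < Num.sqrt 3 :> R by rewrite sqrtr_gt0.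
have v0 : 0 < v by lra.
by split=> //; rewrite -(@sqr_sqrtr R 3)// ler_sqr ?nnegrE; lra.
Qed.

Lemma outside_prob_le_near d (T : measurableType d) (R : realType)
    (P : probability T R) (Z : {RV P >-> R}) (u v : R) : standard_unimodal Z ->
  Num.sqrt 3 <= v -> v <= u -> u <= v + 2 / v ->
  (outside_prob u v Z <= (4 / 9 * ((4 + (u - v) ^+ 2) / (u + v) ^+ 2))%:E)%E.
Proof.
move=> sZ hv vu uv.
have [v0 v3] := sqrt3_le hv.
have uvv : (u - v) * v <= 2 by rewrite -ler_pdivlMr//; lra.
have -> : 4 / 9 * ((4 + (u - v) ^+ 2) / (u + v) ^+ 2) =
   4 * (1 + ((v - u) / 2) ^+ 2) / (9 * ((u + v) / 2) ^+ 2).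
  by field; lra.
apply: outside_prob_le => //; try lra.
have : (u - v) ^+ 2 * v ^+ 2 <= 4.
  have uv0 : 0 <= (u - v) * v by rewrite mulr_ge0//; lra.
  by rewrite -exprMn; nra.
move=> h; have : 3 * (u - v) ^+ 2 <= 4.
  have := sqr_ge0 (u - v); nra.
nra.
Qed.

Lemma outside_prob_le_far d (T : measurableType d) (R : realType)
    (P : probability T R) (Z : {RV P >-> R}) (u v : R) : standard_unimodal Z ->
  Num.sqrt 3 <= v -> v + 2 / v <= u ->
  (outside_prob u v Z <= (4 / 9 * (1 / (1 + v ^+ 2)))%:E)%E.
Proof.
move=> sZ hv uv.
have [v0 v3] := sqrt3_le hv.
have vi0 : 0 < v^-1 by rewrite invr_gt0.
have -> : 4 / 9 * (1 / (1 + v ^+ 2)) =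
   4 * (1 + (- v^-1) ^+ 2) / (9 * (v + v^-1) ^+ 2).
  by field; rewrite ?gt_eqF//; nra.
apply: outside_prob_le => //; try lra.
have -> : 3 * (v + v^-1) ^+ 2 = 3 * v ^+ 2 + 6 + 3 * v^-1 ^+ 2 by field;
  rewrite ?gt_eqF.
have : v^-1 ^+ 2 * 3 <= 1.
  by rewrite exprVn mulrC ler_pdivrMr ?mul1r// exprn_gt0.
rewrite sqrrN; lra.
Qed.

(** * Mixtures of an atom and two adjacent uniform laws *)

Lemma uniform_probE (R : realType) (a b : R) (ab : a < b) (A : set R) :
  measurable A ->
  uniform_prob ab A = ((b - a)^-1%:E * lebesgue_measure (A `&` `[a, b]))%E.
Proof.
move=> mA; rewrite /uniform_prob integral_uniform_pdf.
have mAab : measurable (A `&` `[a, b] : set (measurableTypeR R)).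
  by apply: measurableI => //; exact: measurable_itv.
rewrite (eq_integral (fun=> (b - a)^-1%:E)).
  by rewrite integral_cst.
by move=> x; rewrite inE => -[_ /=]; rewrite in_itv/= /uniform_pdf => ->.
Qed.

Lemma uniform_prob_itv (R : realType) (a b x y : R) (ab : a < b) (s t : bool)
    (A : set R) :
  measurable A -> x <= y ->
  A `&` `[a, b] = [set` Interval (BSide s x) (BSide t y)] ->
  uniform_prob ab A = ((y - x) / (b - a))%:E.
Proof.
move=> mA xy AE; rewrite uniform_probE// AE lebesgue_measure_itv/= lte_fin.
move: xy; rewrite le_eqVlt => /predU1P[->|xy].
  by rewrite ltxx mule0 subrr mul0r.
by rewrite xy -EFinD -EFinM mulrC.
Qed.

Lemma uniform_prob_set0 (R : realType) (a b : R) (ab : a < b) (A : set R) :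
  measurable A -> A `&` `[a, b] = set0 -> uniform_prob ab A = 0%E.
Proof. by move=> mA A0; rewrite uniform_probE// A0 measure0 mule0. Qed.

(** A common form of both extremal laws: the atom sits at the common endpoint
    c, which makes c the mode. *)
Definition three_part_law d (T : measurableType d) (R : realType)
    (P : probability T R) (Z : {RV P >-> R}) (a c b q1 q0 q2 : R)
    (ac : a < c) (cb : c < b) : Prop :=
  forall A : set R, measurable A -> P (Z @^-1` A) =
    (q1%:E * uniform_prob ac A + (q0%:E * \d_c A +
      q2%:E * uniform_prob cb A))%E.

Section three_part_law.
Context d (T : measurableType d) (R : realType) (P : probability T R).
Context (Z : {RV P >-> R}) (a c b q1 q0 q2 : R) (ac : a < c) (cb : c < b).
Hypothesis q1_ge0 : 0 <= q1.
Hypothesis q0_ge0 : 0 <= q0.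
Hypothesis q2_ge0 : 0 <= q2.
Hypothesis law : three_part_law Z q1 q0 q2 ac cb.

Lemma three_part_integral_sqr (t : R) :
  (\int[P]_w ((Z w - t) ^+ 2)%:E =
    (q1 * (((c - t) ^+ 3 - (a - t) ^+ 3) / (3 * (c - a))) + q0 * (c - t) ^+ 2 +
     q2 * (((b - t) ^+ 3 - (c - t) ^+ 3) / (3 * (b - c))))%:E)%E.
Proof.
pose h (x : measurableTypeR R) : \bar R := (quad 1 (- (2 * t)) (t ^+ 2) x)%:E.
have hE (x : R) : ((x - t) ^+ 2)%:E = h x by rewrite /h /quad; congr EFin; ring.
have h0 x : (0 <= h x)%E by rewrite -hE lee_fin sqr_ge0.
have mh : measurable_fun setT h.
  apply/measurable_EFinP.
  exact: continuous_measurable_fun (@continuous_quad _ _ _ _).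
have mZ : measurable_fun setT (Z : T -> R) by exact: measurable_funP.
pose X : T -> R := Z.
pose Zm := isMeasurableFun.Build _ _ T (measurableTypeR R) X mZ.
pose Zr : {mfun T >-> measurableTypeR R} := HB.pack X Zm.
pose m0 : {measure set (measurableTypeR R) -> \bar R} :=
  measure_add (mscale (NngNum q0_ge0) (@dirac _ (measurableTypeR R) c R))
    (mscale (NngNum q2_ge0) (uniform_prob cb)).
pose m : {measure set (measurableTypeR R) -> \bar R} :=
  measure_add (mscale (NngNum q1_ge0) (uniform_prob ac)) m0.
under eq_integral do rewrite hE.
have -> : (\int[P]_w h (Z w) = \int[distribution P Zr]_x h x)%E.
  by rewrite /distribution ge0_integral_pushforward.
rewrite (@eq_measure_integral _ _ _ _ m); last first.
  move=> A mA _; apply: etrans (law mA) _; apply/esym.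
  have m0E : m0 A = (q0%:E * \d_c A + q2%:E * uniform_prob cb A)%E.
    exact: measure_addE.
  by rewrite -m0E; exact: measure_addE.
rewrite /m ge0_integral_measure_add// /m0 ge0_integral_measure_add//.
rewrite !ge0_integral_mscale//= !integral_uniform// integral_dirac//.
rewrite diracT mul1e /h !integral_quad ?(ltW ac) ?(ltW cb)//.
rewrite -!EFinM -!EFinD; congr EFin; rewrite /quad /quad_integral.
by field; rewrite !subr_eq0 !gt_eqF.
Qed.

Lemma three_part_cdf_left (x : R) : x < c ->
  fine (cdf Z x) = q1 * (Num.max 0 (x - a) / (c - a)).
Proof.
move=> xc; rewrite /cdf /distribution /pushforward law;
  last exact: measurable_itv.
rewrite [X in (_ + (_ + _ * X))%E]uniform_prob_set0; first last.
- apply/seteqP; split => // y [] /=; rewrite !in_itv/= => yx /andP[cy _]; lra.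
- exact: measurable_itv.
rewrite diracE memNset ?mule0 ?adde0; last by apply/negP;
  rewrite in_itv/= -ltNge.
have [xa|ax] := leP x a; last first.
  rewrite (@uniform_prob_itv _ _ _ a x _ true false) ?(ltW ax)//.
    by rewrite max_r// subr_ge0 ltW.
  apply/seteqP; split => y /=; rewrite !in_itv/=.
    by move=> [-> /andP[-> _]].
  by move=> /andP[-> yx]; split => //=; lra.
(* An interval that is empty for x < a and the point a for x = a. *)
rewrite (@uniform_prob_itv _ _ _ x x _ (x == a) false)//.
  by rewrite max_l ?subrr ?mul0r// subr_le0.
apply/seteqP; split => y /=; rewrite !in_itv/=.
  move=> [yx /andP[ay _]]; have xE : x = a by lra.
  by rewrite xE eqxx/=; apply/andP; split; lra.
case: eqP => [->|_] /= /andP[h1 h2]; last by lra.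
by split => //; rewrite h1 (le_trans h2 (ltW ac)).
Qed.

Lemma three_part_cdf_right (x : R) : c <= x ->
  fine (cdf Z x) = q1 + q0 + q2 * (Num.min (x - c) (b - c) / (b - c)).
Proof.
move=> cx; rewrite /cdf /distribution /pushforward law;
  last exact: measurable_itv.
rewrite (@uniform_prob_itv _ a c a c _ true false) ?(ltW ac)//; last first.
  apply/seteqP; split => y /=; rewrite !in_itv/=; first by move=> [].
  by move=> /andP[-> yc]; split => //=; lra.
rewrite divff ?subr_eq0 ?gt_eqF// mule1.
rewrite diracE mem_set/= ?in_itv// mule1.
rewrite (@uniform_prob_itv _ c b c (Num.min x b) _ true false)//.
- rewrite /= -addrA; congr (_ + (_ + _ * (_ / _))).
  by case: (leP x b); case: (leP (x - c) (b - c)); lra.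
- by rewrite le_min cx ltW.
- apply/seteqP; split => y /=; rewrite !in_itv/= le_min.
    by move=> [-> /andP[-> ->]].
  by move=> /and3P[-> -> ->].
Qed.

Lemma three_part_unimodal : unimodal_at Z c.
Proof.
have ca : 0 < c - a by rewrite subr_gt0.
have bc : 0 < b - c by rewrite subr_gt0.
split; apply/convex_functionP => x y z;
  rewrite /= !in_itv/= ?andbT => Dx Dz xy yz.
  rewrite !three_part_cdf_left ?(lt_trans yz Dz)//.
  have h : Num.max 0 (y - a) * (z - x) <=
    Num.max 0 (x - a) * (z - y) + Num.max 0 (z - a) * (y - x).
    by case: (leP 0 (x - a)); case: (leP 0 (y - a));
      case: (leP 0 (z - a)) => *; nra.
  move: (Num.max 0 (y - a)) (Num.max 0 (x - a)) (Num.max 0 (z - a)) h =>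
    Y X W h.
  have -> : q1 * (Y / (c - a)) * (z - x) = q1 / (c - a) * (Y * (z - x)) by ring.
  have -> : q1 * (X / (c - a)) * (z - y) + q1 * (W / (c - a)) * (y - x) =
    q1 / (c - a) * (X * (z - y) + W * (y - x)) by ring.
  by rewrite ler_wpM2l// divr_ge0// ltW.
rewrite !three_part_cdf_right ?(le_trans Dx (ltW xy))//.
have h : Num.min (x - c) (b - c) * (z - y) +
  Num.min (z - c) (b - c) * (y - x) <= Num.min (y - c) (b - c) * (z - x).
  by case: (leP (x - c) (b - c)); case: (leP (y - c) (b - c));
    case: (leP (z - c) (b - c)) => *; nra.
move: (Num.min (y - c) (b - c)) (Num.min (x - c) (b - c)) (Num.min (z - c)
  (b - c)) h => Y X W h.
have h' : q2 / (b - c) * (X * (z - y) + W * (y - x)) <=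
  q2 / (b - c) * (Y * (z - x)).
  by rewrite ler_wpM2l// divr_ge0// ltW.
rewrite -subr_ge0; rewrite -subr_ge0 in h'; apply: le_trans h' _.
by rewrite le_eqVlt; apply/orP; left; apply/eqP; ring.
Qed.

End three_part_law.

(** * Affine images of the uniform law *)

Lemma uniform_prob_bnd (R : realType) (a b x y : R) (ab : a < b) (s t : bool) :
  uniform_prob ab [set` Interval (BSide s x) (BSide t y)] =
  (Num.max 0 (Num.min y b - Num.max x a) / (b - a))%:E.
Proof.
rewrite uniform_probE; last exact: measurable_itv.
set A := _ `&` _; pose X := Num.max x a; pose Y := Num.min y b.
have mA : measurable (A : set (measurableTypeR R)).
  by apply: measurableI; exact: measurable_itv.
have subA : A `<=` `[X, Y]%classic.
  move=> w [/=]; rewrite itv_boundlr [in X in _ -> X -> _]in_itv/=.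
  move=> /andP[xw wy] /andP[aw wb].
  have h1 : x <= w by move: xw; case: (s); rewrite bnd_simp// => /ltW.
  have h2 : w <= y by move: wy; case: (t); rewrite bnd_simp// => /ltW.
  by rewrite in_itv/= /X /Y ge_max le_min h1 h2 aw wb.
have supA : `]X, Y[%classic `<=` A.
  move=> w /=; rewrite in_itv/= /X /Y gt_max lt_min =>
    /andP[/andP[xw aw] /andP[wy wb]].
  split => /=; last by rewrite in_itv/= !ltW.
  by case: (s); case: (t); rewrite in_itv/= ?(ltW xw) ?(ltW wy) ?xw ?wy.
have lebE u v : lebesgue_measure [set` Interval (BSide u X) (BSide v Y)] =
    (Num.max 0 (Y - X))%:E.
  rewrite lebesgue_measure_itv/= lte_fin; case: ltP => XY.
    by rewrite -EFinD max_r// subr_ge0 ltW.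
  by rewrite max_l// subr_le0.
have -> : lebesgue_measure A = (Num.max 0 (Y - X))%:E.
  apply/eqP; rewrite eq_le; apply/andP; split.
    by rewrite -(lebE true false); apply: le_measure; rewrite ?inE//.
  by rewrite -(lebE false true); apply: le_measure; rewrite ?inE//.
by rewrite -EFinM mulrC.
Qed.

Lemma eq_measure_ocitv (R : realType)
    (m1 m2 : {finite_measure set (measurableTypeR R) -> \bar R}) :
  (forall a b : R, a <= b -> m1 `]a, b]%classic = m2 `]a, b]%classic) ->
  forall A : set (measurableTypeR R), measurable A -> m1 A = m2 A.
Proof.
move=> m12 A mA; apply/eqP; rewrite eq_le; apply/andP; split.
  by apply: le_measure_ocitv => // a b ab; rewrite m12.
by apply: le_measure_ocitv => // a b ab; rewrite m12.
Qed.

Lemma max0_pMr (R : realType) (s x : R) : 0 < s ->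
  Num.max 0 (s * x) = s * Num.max 0 x.
Proof. by move=> s0; rewrite -{1}(mulr0 s) maxr_pMr// ltW. Qed.

Lemma uniform_prob_affine (R : realType) (c s : R) (A : set R)
    (cs : c < c + s) : measurable A ->
  uniform_prob (@ltr01 R) ((fun x => c + s * x) @^-1` A) = uniform_prob cs A.
Proof.
move=> mA; have s0 : 0 < s by lra.
pose f (x : measurableTypeR R) : measurableTypeR R := c + s * x.
have mf : measurable_fun setT f.
  by apply: (@measurable_funD _ _ R setT (cst c) (fun x => s * x)) => //;
    apply: measurable_funM.
pose fm := isMeasurableFun.Build _ _ (measurableTypeR R)
  (measurableTypeR R) f mf.
pose fr : {mfun measurableTypeR R >-> measurableTypeR R} := HB.pack f fm.
apply: (@eq_measure_ocitv R (distribution (uniform_prob (@ltr01 R)) fr)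
  (uniform_prob cs)) => // p q pq.
suff : uniform_prob (@ltr01 R) (f @^-1` `]p, q]) = uniform_prob cs `]p, q]
  by [].
rewrite [RHS]uniform_prob_bnd.
have -> : f @^-1` `]p, q] = `](p - c) / s, (q - c) / s]%classic.
  by apply/seteqP; split => x;
    rewrite /= !in_itv/= ltr_pdivrMr// ler_pdivlMr// /f; lra.
rewrite uniform_prob_bnd; congr EFin; rewrite subr0 divr1 [c + s]addrC addrK.
set p' := (p - c) / s; set q' := (q - c) / s.
have -> : p = c + s * p' by rewrite /p'; field; lra.
have -> : q = c + s * q' by rewrite /q'; field; lra.
have -> : Num.min (c + s * q') (s + c) - Num.max (c + s * p') c =
    s * (Num.min q' 1 - Num.max p' 0).
  by case: (leP q' 1); case: (leP p' 0); case: (leP (c + s * q') (s + c));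
    case: (leP (c + s * p') c) => *; nra.
by rewrite max0_pMr//; field; lra.
Qed.

(** Kept apart from the increasing case because the preimage of a half-open
    interval changes its orientation. *)
Lemma uniform_prob_affineN (R : realType) (c s : R) (A : set R)
    (cs : c - s < c) : measurable A ->
  uniform_prob (@ltr01 R) ((fun x => c - s * x) @^-1` A) = uniform_prob cs A.
Proof.
move=> mA; have s0 : 0 < s by lra.
pose f (x : measurableTypeR R) : measurableTypeR R := c - s * x.
have mf : measurable_fun setT f.
  by apply: (@measurable_funB _ _ R setT (cst c) (fun x => s * x)) => //;
    apply: measurable_funM.
pose fm := isMeasurableFun.Build _ _ (measurableTypeR R)
  (measurableTypeR R) f mf.
pose fr : {mfun measurableTypeR R >-> measurableTypeR R} := HB.pack f fm.
apply: (@eq_measure_ocitv R (distribution (uniform_prob (@ltr01 R)) fr)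
  (uniform_prob cs)) => // p q pq.
suff : uniform_prob (@ltr01 R) (f @^-1` `]p, q]) = uniform_prob cs `]p, q]
  by [].
rewrite [RHS]uniform_prob_bnd.
have -> : f @^-1` `]p, q] = `[(c - q) / s, (c - p) / s[%classic.
  by apply/seteqP; split => x;
    rewrite /= !in_itv/= ltr_pdivlMr// ler_pdivrMr// /f; lra.
rewrite uniform_prob_bnd; congr EFin; rewrite subr0 divr1 subKr.
set q' := (c - q) / s; set p' := (c - p) / s.
have -> : p = c - s * p' by rewrite /p'; field; lra.
have -> : q = c - s * q' by rewrite /q'; field; lra.
have -> : Num.min (c - s * q') c - Num.max (c - s * p') (c - s) =
    s * (Num.min p' 1 - Num.max q' 0).
  by case: (leP p' 1); case: (leP q' 0); case: (leP (c - s * q') c);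
    case: (leP (c - s * p') (c - s)) => *; nra.
by rewrite max0_pMr//; field; lra.
Qed.

(** * The extremal laws *)

(** The second moments about 0 and about -1 determine the mean and the
    variance. *)
Lemma three_part_standard_unimodal d (T : measurableType d) (R : realType)
    (P : probability T R) (Z : {RV P >-> R}) (a c b q1 q0 q2 : R)
    (ac : a < c) (cb : c < b) :
  0 <= q1 -> 0 <= q0 -> 0 <= q2 -> three_part_law Z q1 q0 q2 ac cb ->
  (forall t : R, t = 0 \/ t = -1 ->
    q1 * (((c - t) ^+ 3 - (a - t) ^+ 3) / (3 * (c - a))) + q0 * (c - t) ^+ 2 +
     q2 * (((b - t) ^+ 3 - (c - t) ^+ 3) / (3 * (b - c))) = 1 + t ^+ 2) ->
  standard_unimodal Z.
Proof.
move=> q1_ge0 q0_ge0 q2_ge0 law moments.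
have sqr t : t = 0 \/ t = -1 ->
  (\int[P]_w ((Z w - t) ^+ 2)%:E = (1 + t ^+ 2)%:E)%E.
  by move=> tE;
    rewrite (three_part_integral_sqr q1_ge0 q0_ge0 q2_ge0 law) moments.
apply: standard_unimodalP.
- by exists c; exact: three_part_unimodal law.
- have := sqr 0 (or_introl erefl); under eq_integral do rewrite subr0.
  by move=> ->; rewrite expr0n addr0.
- have := sqr (-1) (or_intror erefl); under eq_integral do rewrite opprK.
  by move=> ->; congr EFin; ring.
Qed.

Lemma outside_probE d (T : measurableType d) (R : realType)
    (P : probability T R) (Z : {RV P >-> R}) (u v : R) :
  outside_prob u v Z = P (Z @^-1` (`]-oo, - u]%classic `|` `[v, +oo[%classic)).
Proof.
by congr (P _); apply/seteqP; split => w /=; rewrite !in_itv/= andbT.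
Qed.

Lemma uniform_outside_right (R : realType) (u v a b : R) (ab : a < b) :
  - u < a -> a <= v -> v <= b ->
  uniform_prob ab (`]-oo, - u]%classic `|` `[v, +oo[%classic) =
  ((b - v) / (b - a))%:E.
Proof.
move=> ua av vb; apply: (@uniform_prob_itv _ _ _ _ _ _ true false) => //.
  by apply: measurableU.
apply/seteqP; split => x /=; rewrite !in_itv/= ?andbT.
  by move=> [[h|->] /andP[h1 h2]]//; lra.
by move=> /andP[vx xb]; split; [right|apply/andP; split; lra].
Qed.

Lemma uniform_outside_left (R : realType) (u v a b : R) (ab : a < b) :
  a <= - u -> - u <= b -> b < v ->
  uniform_prob ab (`]-oo, - u]%classic `|` `[v, +oo[%classic) =
  ((- u - a) / (b - a))%:E.
Proof.
move=> au ub bv; apply: (@uniform_prob_itv _ _ _ _ _ _ true false) => //.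
  by apply: measurableU.
apply/seteqP; split => x /=; rewrite !in_itv/= ?andbT.
  by move=> [[->|h] /andP[h1 h2]]//; lra.
by move=> /andP[ax xu]; split; [left|apply/andP; split; lra].
Qed.

Lemma dirac_outside (R : realType) (u v c : R) : - u < c -> c < v ->
  \d_c (`]-oo, - u]%classic `|` `[v, +oo[%classic : set R) = 0%E :> \bar R.
Proof.
move=> uc cv; rewrite diracE memNset// => -[]/=; rewrite in_itv/= ?andbT; lra.
Qed.

(** The values - l, 0 and l of Y exhaust the probability, and given Y = y the
    variable is the affine image c + U y of a uniform one, by independence. *)
Lemma scale_mixture_law d (T : measurableType d) (R : realType)
    (P : probability T R) (U Y Z : {RV P >-> R}) (c l q1 q0 q2 : R)
    (ac : c - l < c) (cb : c < c + l) :
  (forall A : set R, measurable A ->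
     distribution P U A = uniform_prob (@ltr01 R) A) ->
  P [set w | Y w = - l] = q1%:E -> P [set w | Y w = 0] = q0%:E ->
  P [set w | Y w = l] = q2%:E -> q1 + q0 + q2 = 1 ->
  independent_RVs U Y -> (forall w, Z w = c + U w * Y w) ->
  three_part_law Z q1 q0 q2 ac cb.
Proof.
move=> Ulaw P1 P0 P2 q1E UY ZE A mA; have l0 : 0 < l by lra.
have mpre (X : {RV P >-> R}) (B : set R) : measurable B ->
  measurable (X @^-1` B).
  by move=> mB; exact: measurable_funPTI.
pose E y := Z @^-1` A `&` Y @^-1` [set y].
have mE y : measurable (E y) by apply: measurableI; exact: mpre.
have EE y q : P (Y @^-1` [set y]) = q%:E -> P (E y) =
    (q%:E * uniform_prob (@ltr01 R) ((fun x => (c + x * y)%R) @^-1` A))%E.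
  move=> Yq.
  have mB : measurable ((fun x : R => c + x * y) @^-1` A).
    rewrite -[X in measurable X]setTI.
    have mf : measurable_fun setT (fun x : R => c + x * y).
      by apply: measurable_funD => //; exact: measurable_funM.
    exact: mf.
  rewrite -Yq muleC -Ulaw// -UY//; congr (P _); apply/seteqP;
    split => w [/= Aw Yw]; split => //=.
    by rewrite -Yw -ZE.
  by rewrite ZE Yw.
pose N := ~` (Y @^-1` [set (- l)%R] `|` (Y @^-1` [set 0] `|` Y @^-1` [set l])).
have disjY (y z : R) : y != z -> Y @^-1` [set y] `&` Y @^-1` [set z] = set0.
  by move=> yz; apply/seteqP; split => // w /= [-> yE]; rewrite yE eqxx in yz.
have lN0 : - l != 0 by rewrite oppr_eq0 gt_eqF.
have lNl : - l != l by rewrite lt_eqF//; lra.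
have l00 : 0 != l by rewrite lt_eqF.
have PN : P N = 0%E.
  rewrite /N probability_setC; last first.
    by apply: measurableU; [|apply: measurableU]; exact: mpre.
  rewrite measureU; [|exact: mpre|by apply: measurableU; exact: mpre|].
    rewrite measureU; [|exact: mpre|exact: mpre|exact: disjY].
    rewrite [X in (_ - (X + _))%E](_ : _ = q1%:E)//.
    rewrite [X in (_ - (_ + (X + _)))%E](_ : _ = q0%:E)//.
    rewrite [X in (_ - (_ + (_ + X)))%E](_ : _ = q2%:E)//.
    by rewrite -!EFinD; congr EFin; lra.
  by rewrite setIUr !disjY// setU0.
have mN : measurable N.
  by apply: measurableC; apply: measurableU; [|apply: measurableU]; exact: mpre.
have -> : Z @^-1` A = E (- l) `|` (E 0 `|` (E l `|` (Z @^-1` A `&` N))).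
  apply/seteqP; split => w /=; last by move=> [[]|[[]|[[]|[]]]].
  move=> Aw; have [|] := pselect (N w); first by right; right; right.
  by move=> /notP[|[|]] Yw; [left|right; left|right; right; left].
have disjE (y z : R) : y != z -> E y `&` E z = set0.
  move=> yz; apply/seteqP; split => // w [[_ h1] [_ h2]].
  by rewrite -[set0](disjY _ _ yz).
have disjN y : y = - l \/ y = 0 \/ y = l -> E y `&` (Z @^-1` A `&` N) = set0.
  move=> yE; apply/seteqP; split => // w [[_ /= h1] [_ []]].
  by case: yE => [yE|[yE|yE]]; rewrite -yE; [left|right; left|right; right].
have mAN : measurable (Z @^-1` A `&` N) by apply: measurableI => //;
  exact: mpre.
have PAN : P (Z @^-1` A `&` N) = 0%E.
  by apply/eqP; rewrite eq_le measure_ge0 andbT -PN; apply: le_measure;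
    rewrite ?inE//; exact: subIsetr.
rewrite measureU//; [|by apply: measurableU => //; exact: measurableU|];
  last first.
  by rewrite !setIUr !disjE// disjN ?setU0//; left.
rewrite measureU//; [|exact: measurableU|]; last first.
  by rewrite !setIUr !disjE// disjN ?setU0//; right; left.
rewrite measureU//; last by rewrite disjN//; right; right.
rewrite [X in (_ + (_ + (_ + X)))%E](_ : _ = 0%E)// adde0.
congr (_ + (_ + _))%E.
- apply: etrans (EE _ _ P1) _; congr (_ * _)%E;
    rewrite -uniform_prob_affineN//; congr (uniform_prob _ _).
  by apply/funext => x /=; rewrite mulrN mulrC.
- apply: etrans (EE _ _ P0) _; congr (_ * _)%E; rewrite diracE.
  have -> : (fun x : R => c + x * 0) @^-1` A = if c \in A then setT else set0.
    apply/seteqP; split => x /=; rewrite mulr0 addr0.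
      by move=> /mem_set ->.
    by case: ifPn => // /set_mem.
  case: ifPn => _; last by rewrite measure0.
  exact: probability_setT.
- apply: etrans (EE _ _ P2) _; congr (_ * _)%E; rewrite -uniform_prob_affine//;
    congr (uniform_prob _ _).
  by apply/funext => x /=; rewrite mulrC.
Qed.

(** The sum of the weights is an argument of the definition because the
    structure of a probability depends on it. *)
Section mixture.
Context d (T : measurableType d) (R : realType) (P1 P0 P2 : probability T R).
Context (q1 q0 q2 : {nonneg R}).

Definition mixture (q : q1%:num + q0%:num + q2%:num = 1) : set T -> \bar R :=
  measure_add (mscale q1 P1) (measure_add (mscale q0 P0) (mscale q2 P2)).

Hypothesis q : q1%:num + q0%:num + q2%:num = 1.

HB.instance Definition _ := Measure.on (mixture q).

Lemma mixtureE A : mixture q A =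
  (q1%:num%:E * P1 A + (q0%:num%:E * P0 A + q2%:num%:E * P2 A))%E.
Proof. by rewrite /mixture measure_addE; congr (_ + _)%E;
  exact: measure_addE. Qed.

Let mixture_setT : mixture q setT = 1%E.
Proof. by rewrite mixtureE !probability_setT !mule1 -!EFinD addrA q. Qed.

HB.instance Definition _ :=
  Measure_isProbability.Build _ _ R (mixture q) mixture_setT.

End mixture.

Lemma mixture_probability d (T : measurableType d) (R : realType)
    (P1 P0 P2 : probability T R) (q1 q0 q2 : R) :
  0 <= q1 -> 0 <= q0 -> 0 <= q2 -> q1 + q0 + q2 = 1 ->
  exists P : probability T R, forall A : set T,
    P A = (q1%:E * P1 A + (q0%:E * P0 A + q2%:E * P2 A))%E.
Proof.
move=> h1 h0 h2 q.
exists (@mixture _ _ _ P1 P0 P2 (NngNum h1) (NngNum h0) (NngNum h2) q).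
exact: mixtureE.
Qed.

Lemma near_weights_ge0 (R : realType) (u v : R) :
  Num.sqrt 3 <= v -> v <= u -> u <= v + 2 / v ->
  [/\ 0 < v, 0 <= 4 / 3 * ((2 + v * (v - u)) / (u + v) ^+ 2),
    0 <= 1 - 4 / 3 * ((4 + (v - u) ^+ 2) / (u + v) ^+ 2) &
    0 <= 4 / 3 * ((2 + u * (u - v)) / (u + v) ^+ 2)].
Proof.
move=> hv vu uv.
have [v0 v3] := sqrt3_le hv.
have uvv : (u - v) * v <= 2 by rewrite -ler_pdivlMr//; lra.
have d0 : 0 <= u - v by lra.
have D0 : 0 < (u + v) ^+ 2 by rewrite exprn_gt0//; lra.
split => //.
- by rewrite mulr_ge0// divr_ge0 ?(ltW D0)//; lra.
- rewrite subr_ge0 mulrA ler_pdivrMr// mul1r.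
  have dv : u - v <= v by rewrite -(ler_pM2r v0) -expr2; lra.
  have : (u - v) ^+ 2 <= (u - v) * v by rewrite expr2 ler_wpM2l.
  nra.
- by rewrite mulr_ge0// divr_ge0 ?(ltW D0)//; nra.
Qed.

Lemma scale_mixture_extremal_law d (T : measurableType d) (R : realType)
    (P : probability T R) (u v : R) (U Y Z : {RV P >-> R})
    (l := 3 / 4 * (u + v)) (c := (v - u) / 2)
    (ac : c - l < c) (cb : c < c + l) :
  0 < u + v -> scale_mixture_extremal u v U Y Z ->
  three_part_law Z (4 / 3 * ((2 + v * (v - u)) / (u + v) ^+ 2))
    (1 - 4 / 3 * ((4 + (v - u) ^+ 2) / (u + v) ^+ 2))
    (4 / 3 * ((2 + u * (u - v)) / (u + v) ^+ 2)) ac cb.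
Proof.
move=> uv0 [Ulaw [P1 P0 P2] UY ZE];
  apply: scale_mixture_law Ulaw P1 P0 P2 _ UY ZE.
by field; rewrite gt_eqF.
Qed.

Lemma scale_mixture_extremal_attains d (T : measurableType d) (R : realType)
    (P : probability T R) (u v : R) (U Y Z : {RV P >-> R}) :
  Num.sqrt 3 <= v -> v <= u -> u <= v + 2 / v ->
  scale_mixture_extremal u v U Y Z ->
  standard_unimodal Z /\
  outside_prob u v Z = (4 / 9 * ((4 + (u - v) ^+ 2) / (u + v) ^+ 2))%:E.
Proof.
move=> hv vu uv ext; have [v0 q1 q0 q2] := near_weights_ge0 hv vu uv.
have uv0 : 0 < u + v by lra.
set l := 3 / 4 * (u + v); set c := (v - u) / 2.
have ac : c - l < c by rewrite /l; lra.
have cb : c < c + l by rewrite /l; lra.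
have law := @scale_mixture_extremal_law _ _ _ _ _ _ _ _ _ ac cb uv0 ext.
have lE : [/\ c - (c - l) = l, c + l - c = l, - u - (c - l) = l / 3 &
    c + l - v = l / 3].
  by rewrite /l /c; split; lra.
have [l1 l2 l3 l4] := lE.
split.
  apply: (three_part_standard_unimodal q1 q0 q2 law) => t [->|->];
    by rewrite l1 l2 /l /c; field; rewrite ?mulf_neq0 ?gt_eqF.
rewrite outside_probE law; last by apply: measurableU.
have [h1 h2 h3 h4] : [/\ c - l <= - u, - u < c, c < v & v <= c + l].
  by rewrite /l /c; split; lra.
rewrite uniform_outside_left ?(ltW h2)// dirac_outside//.
rewrite uniform_outside_right ?(ltW h3)//.
rewrite l1 l2 l3 l4 mule0 add0e -!EFinM -EFinD; congr EFin.
by rewrite /l /c; field; rewrite ?mulf_neq0 ?gt_eqF.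
Qed.

Lemma atom_uniform_extremal_attains d (T : measurableType d) (R : realType)
    (P : probability T R) (u v : R) (Z : {RV P >-> R}) :
  Num.sqrt 3 <= v -> v + 2 / v <= u -> atom_uniform_extremal v Z ->
  standard_unimodal Z /\
  outside_prob u v Z = (4 / 9 * (1 / (1 + v ^+ 2)))%:E.
Proof.
move=> hv uv [cb Zlaw].
have [v0 v3] := sqrt3_le hv.
have vi0 : 0 < v^-1 by rewrite invr_gt0.
have D0 : 0 < 3 * (1 + v ^+ 2) by lra.
have q0 : 0 <= (3 * v ^+ 2 - 1) / (3 * (1 + v ^+ 2))
  by rewrite divr_ge0 ?ltW//; lra.
have q2 : 0 <= 4 / (3 * (1 + v ^+ 2)) by rewrite divr_ge0 ?ltW.
(* The left uniform part has weight 0, so its left endpoint is arbitrary. *)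
have ac : - v^-1 - 1 < - v^-1 by lra.
have law : three_part_law Z 0 ((3 * v ^+ 2 - 1) / (3 * (1 + v ^+ 2)))
    (4 / (3 * (1 + v ^+ 2))) ac cb.
  by move=> A mA; rewrite mul0e add0e; exact: Zlaw.
have bE : (1 + 3 * v ^+ 2) / (2 * v) = v + (v + v^-1) / 2.
  by field; rewrite gt_eqF.
have v2n : 1 + v ^+ 2 != 0 by rewrite gt_eqF//; lra.
split.
  apply: (three_part_standard_unimodal (lexx 0) q0 q2 law) => t [->|->];
    by rewrite mul0r add0r; field; rewrite ?mulf_neq0 ?gt_eqF//; nra.
rewrite outside_probE law; last by apply: measurableU.
have [h1 h2 h3]
  : [/\ - u < - v^-1, - v^-1 < v & v <= (1 + 3 * v ^+ 2) / (2 * v)].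
  by rewrite bE; split; lra.
rewrite mul0e add0e dirac_outside// uniform_outside_right ?(ltW h2)//.
rewrite mule0 add0e -EFinM; congr EFin.
by field; rewrite ?mulf_neq0 ?gt_eqF//; nra.
Qed.

Lemma scale_mixture_extremal_exists (R : realType) (u v : R) :
  Num.sqrt 3 <= v -> v <= u -> u <= v + 2 / v ->
  exists (d : measure_display) (T : measurableType d)
    (P : probability T R) (U Y Z : {RV P >-> R}),
    scale_mixture_extremal u v U Y Z.
Proof.
move=> hv vu uv; have [v0 q1 q0 q2] := near_weights_ge0 hv vu uv.
set l := 3 / 4 * (u + v); have l0 : 0 < l by rewrite /l; lra.
pose D (x : R) : probability (measurableTypeR R) R :=
  @dirac _ (measurableTypeR R) x R.
have q : 4 / 3 * ((2 + v * (v - u)) / (u + v) ^+ 2) +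
    (1 - 4 / 3 * ((4 + (v - u) ^+ 2) / (u + v) ^+ 2)) +
    4 / 3 * ((2 + u * (u - v)) / (u + v) ^+ 2) = 1.
  by field; rewrite gt_eqF//; lra.
have [PY PYE] := mixture_probability (D (- l)) (D 0) (D l) q1 q0 q2 q.
pose PU : probability (measurableTypeR R) R := uniform_prob (@ltr01 R).
pose P : probability (measurableTypeR R * measurableTypeR R)%type R :=
  (PU \x PY)%E.
pose Ufun (w : measurableTypeR R * measurableTypeR R) : R := w.1.
pose Yfun (w : measurableTypeR R * measurableTypeR R) : R := w.2.
have mU : measurable_fun setT Ufun by exact: measurable_fst.
have mY : measurable_fun setT Yfun by exact: measurable_snd.
pose Zfun (w : measurableTypeR R * measurableTypeR R) : R :=
  (v - u) / 2 + Ufun w * Yfun w.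
have mZ : measurable_fun setT Zfun.
  by apply: measurable_funD => //; exact: measurable_funM.
pose Um := isMeasurableFun.Build _ _ _ _ Ufun mU.
pose Ym := isMeasurableFun.Build _ _ _ _ Yfun mY.
pose Zm := isMeasurableFun.Build _ _ _ _ Zfun mZ.
pose U : {RV P >-> R} := HB.pack Ufun Um.
pose Y : {RV P >-> R} := HB.pack Yfun Ym.
pose Z : {RV P >-> R} := HB.pack Zfun Zm.
have PUY (A B : set R) : measurable A -> measurable B ->
    P (U @^-1` A `&` Y @^-1` B) = (PU A * PY B)%E.
  move=> mA mB; rewrite -product_measure1E//; congr (_ _).
have PUE (A : set R) : measurable A -> P (U @^-1` A) = PU A.
  move=> mA; rewrite -[X in P X]setIT -[X in _ `&` X](preimage_setT Y) PUY//.
  by rewrite probability_setT mule1.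
have PYE' (B : set R) : measurable B -> P (Y @^-1` B) = PY B.
  move=> mB; rewrite -[X in P X]setTI -[X in X `&` _](preimage_setT U) PUY//.
  by rewrite probability_setT mul1e.
exists _, _, P, U, Y, Z; split => //.
- have dE (x y : R) : D x [set y] = ((x == y)%:R)%:E.
    by rewrite /D /= diracE in_set1.
  have neq1 : (- l == 0) = false by lra.
  have neq2 : (- l == l) = false by lra.
  have neq3 : (l == 0) = false by lra.
  have neq4 : (0 == l) = false by lra.
  have neq5 : (l == - l) = false by lra.
  have neq6 : (0 == - l) = false by lra.
  split.
  + apply: etrans (PYE' [set (- l)] (measurable_set1 _)) _.
    by rewrite PYE !dE eqxx neq5 neq6 !mule0 !adde0 mule1.
  + apply: etrans (PYE' [set 0] (measurable_set1 _)) _.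
    by rewrite PYE !dE eqxx neq1 neq3 !mule0 !adde0 add0e mule1.
  + apply: etrans (PYE' [set l] (measurable_set1 _)) _.
    by rewrite PYE !dE eqxx neq2 neq4 !mule0 !add0e mule1.
- by move=> A B mA mB; rewrite PUY// PUE// PYE'.
Qed.

Lemma atom_uniform_extremal_exists (R : realType) (v : R) : Num.sqrt 3 <= v ->
  exists (d : measure_display) (T : measurableType d)
    (P : probability T R) (Z : {RV P >-> R}), atom_uniform_extremal v Z.
Proof.
move=> hv.
have [v0 v3] := sqrt3_le hv.
have vi0 : 0 < v^-1 by rewrite invr_gt0.
have D0 : 0 < 3 * (1 + v ^+ 2) by lra.
have q0 : 0 <= (3 * v ^+ 2 - 1) / (3 * (1 + v ^+ 2))
  by rewrite divr_ge0 ?ltW//; lra.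
have q2 : 0 <= 4 / (3 * (1 + v ^+ 2)) by rewrite divr_ge0 ?ltW.
have cb : - v^-1 < (1 + 3 * v ^+ 2) / (2 * v).
  have -> : (1 + 3 * v ^+ 2) / (2 * v) = v + (v + v^-1) / 2.
    by field; rewrite gt_eqF.
  lra.
have q : 0 + (3 * v ^+ 2 - 1) / (3 * (1 + v ^+ 2)) + 4 / (3 * (1 + v ^+ 2)) = 1.
  by field; rewrite gt_eqF//; lra.
(* The first component has weight 0; any probability would do. *)
have [P PE] := mixture_probability (uniform_prob cb)
  (@dirac _ (measurableTypeR R) (- v^-1) R) (uniform_prob cb) (lexx 0) q0 q2 q.
pose Zfun (w : measurableTypeR R) : R := w.
have mZ : measurable_fun setT Zfun by exact: measurable_id.
pose Zm := isMeasurableFun.Build _ _ _ _ Zfun mZ.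
pose Z : {RV P >-> R} := HB.pack Zfun Zm.
exists _, _, P, Z, cb => A mA.
by apply: etrans (PE A) _; rewrite mul0e add0e.
Qed.

Theorem theorem5p4 (R : realType) (u v : R)
    (hv : Num.sqrt 3 <= v) (hvu : v <= u) :
  [/\ forall (d : measure_display) (T : measurableType d)
          (P : probability T R) (Z : {RV P >-> R}),
        standard_unimodal Z ->
        (u <= v + 2 / v ->
          (outside_prob u v Z <=
            (4 / 9 * ((4 + (u - v) ^+ 2) / (u + v) ^+ 2))%:E)%E) /\
        (v + 2 / v <= u ->
          (outside_prob u v Z <= (4 / 9 * (1 / (1 + v ^+ 2)))%:E)%E),
      u <= v + 2 / v ->
        (forall (d : measure_display) (T : measurableType d)
            (P : probability T R) (U Y Z : {RV P >-> R}),
          scale_mixture_extremal u v U Y Z ->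
          standard_unimodal Z /\
          outside_prob u v Z =
            (4 / 9 * ((4 + (u - v) ^+ 2) / (u + v) ^+ 2))%:E) /\
        (exists (d : measure_display) (T : measurableType d)
            (P : probability T R) (U Y Z : {RV P >-> R}),
          scale_mixture_extremal u v U Y Z)
    & v + 2 / v <= u ->
        (forall (d : measure_display) (T : measurableType d)
            (P : probability T R) (Z : {RV P >-> R}),
          atom_uniform_extremal v Z ->
          standard_unimodal Z /\
          outside_prob u v Z = (4 / 9 * (1 / (1 + v ^+ 2)))%:E) /\
        (exists (d : measure_display) (T : measurableType d)
            (P : probability T R) (Z : {RV P >-> R}),
          atom_uniform_extremal v Z)].
Proof.
split=> [d T P Z sZ|uv|uv].
- by split=> uv; [exact: outside_prob_le_near|exact: outside_prob_le_far].
- split=> [d T P U Y Z|]; first exact: scale_mixture_extremal_attains.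
  exact: scale_mixture_extremal_exists.
- split=> [d T P Z|]; first exact: atom_uniform_extremal_attains.
  exact: atom_uniform_extremal_exists.
Qed.
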